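(* Let $K^*\in\mathcal{K}$ denote the global optimum of $\min_{K\in\mathcal{K}}\mathcal{J}(K)$ of the form $K^*=(R+B^\top\tilde P_{K^*}B)^{-1}B^\top\tilde P_{K^*}A$. Suppose $K_0\in\mathcal{K}$ and $\|K_0\|<\infty$. Let $\{K_n\}_{n\ge0}$ be generated from $K_0$, with a constant stepsize $\eta>0$, by either (a) the natural policy gradient iteration $K_{n+1}=K_n-2\eta E_{K_n}$ with $\eta\le \dfrac{1}{2\|R+B^\top\tilde P_{K_0}B\|}$, or (b) the Gauss–Newton iteration $K_{n+1}=K_n-2\eta(R+B^\top\tilde P_{K_n}B)^{-1}E_{K_n}$ with $\eta\le\dfrac12$. Then the iterates converge to the global optimum $K^*$ in the sense that the average of $\{\|E_{K_n}\|_F^2\}$ over iterations converges to zero with $O(1/N)$ rate, i.e., there is a constant $c$ such that for all $N\ge1$ $$\frac1N\sum_{n=0}^{N-1}\|E_{K_n}\|_F^2\le\frac{c}{N}.$$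
   Context: Setting (discrete-time mixed $\mathcal{H}_2/\mathcal{H}_\infty$ design). $A\in\mathbb{R}^{m\times m}$, $B\in\mathbb{R}^{m\times d}$, $C\in\mathbb{R}^{l\times m}$, $D\in\mathbb{R}^{m\times n}$, $E\in\mathbb{R}^{l\times d}$ are real matrices satisfying $E^\top[C\ \ E]=[0\ \ R]$ for some $R>0$, and $\gamma>0$. Gains are $K\in\mathbb{R}^{d\times m}$. $\rho(\cdot)$ is the spectral radius, $\|\cdot\|$ the operator norm, $\|\cdot\|_F$ the Frobenius norm, $X>0$ ($X\ge0$) denotes (symmetric) positive definite (semidefinite), $X^{-\top}=(X^{-1})^\top$. A square matrix is stable if its spectral radius is $<1$. Transfer function: $\mathcal{T}(K)(z)=(C^\top C+K^\top RK)^{1/2}\,(zI-(A-BK))^{-1}D$, with $\|\mathcal{T}(K)\|_\infty=\sup_{\theta\in[0,2\pi)}\lambda_{\max}^{1/2}\big[\mathcal{T}(K)(e^{-j\theta})^\top \mathcal{T}(K)(e^{j\theta})\big]$. Feasible set: $\mathcal{K}=\{K:\rho(A-BK)<1,\ \|\mathcal{T}(K)\|_\infty<\gamma\}$. For $K\in\mathcal{K}$, $P_K$ denotes the unique stabilizing solution (it exists by the discrete-time Bounded Real Lemma) of the Riccati equation $(A-BK)^\top\tilde P_K(A-BK)+C^\top C+K^\top RK-P_K=0$, where $\tilde P_K:=P_K+P_KD(\gamma^2I-D^\top P_KD)^{-1}D^\top P_K$; i.e., the unique solution $P_K\ge0$ with $I-\gamma^{-2}D^\top P_KD>0$ and $(I-\gamma^{-2}P_KDD^\top)^{-\top}(A-BK)$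 stable. Also $E_K:=(R+B^\top\tilde P_KB)K-B^\top\tilde P_KA$. Cost: $\mathcal{J}(K)=-\gamma^2\log\det(I-\gamma^{-2}P_KDD^\top)$ for $K\in\mathcal{K}$. *)

(* Defs.v *)
From HB Require Import structures.
From mathcomp Require Import all_boot all_order all_algebra.
From mathcomp Require Import all_classical all_reals all_analysis.
From mathcomp Require Import complex.

Set Implicit Arguments.
Unset Strict Implicit.
Unset Printing Implicit Defensive.

Import Order.TTheory GRing.Theory Num.Theory.

Local Open Scope classical_set_scope.
Local Open Scope ring_scope.
Local Open Scope complex_scope.

(* [`|M|] on matrices is the max-entry norm in MathComp-Analysis, so the
   Frobenius and operator norms are defined here.  On a column vector [fnorm]
   is the Euclidean norm. *)
Definition fnorm (R : realType) (p q : nat) (M : 'M[R]_(p, q)) : R :=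
  Num.sqrt (\sum_i \sum_j M i j ^+ 2).

Definition opnorm (R : realType) (p q : nat) (M : 'M[R]_(p, q)) : R :=
  sup [set fnorm (M *m x) | x in [set x : 'cV[R]_q | fnorm x <= 1]].

Definition possemidef (R : realType) (p : nat) (M : 'M[R]_p) : Prop :=
  M \is symmetricmx /\ forall x : 'cV[R]_p, 0 <= (x^T *m M *m x) 0 0.

Definition posdef (R : realType) (p : nat) (M : 'M[R]_p) : Prop :=
  M \is symmetricmx /\
  forall x : 'cV[R]_p, x != 0 -> 0 < (x^T *m M *m x) 0 0.

(* The eigenvalues are the complex ones. *)
Definition spectral_radius (R : realType) (p : nat) (M : 'M[R]_p) : R :=
  sup [set ComplexField.Normc.normc a
      | a in [set a : R[i] | eigenvalue (map_mx (real_complex R) M) a]].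

Definition stable (R : realType) (p : nat) (M : 'M[R]_p) : Prop :=
  spectral_radius M < 1.

(* Largest eigenvalue; meant for Hermitian [M], whose eigenvalues are real. *)
Definition lambda_max (R : realType) (p : nat) (M : 'M[R[i]]_p) : R :=
  sup [set x : R | eigenvalue M x%:C].

(* The positive semidefinite square root of a positive semidefinite [M]. *)
Definition sqrtmx (R : realType) (p : nat) (M : 'M[R]_p) : 'M[R]_p :=
  xget 0 [set S | possemidef S /\ S *m S = M].

Definition expi (R : realType) (t : R) : R[i] := cos t +i* sin t.

Record plant (R : realType) (m d l n : nat) := Plant {
  plA : 'M[R]_m;
  plB : 'M[R]_(m, d);
  plC : 'M[R]_(l, m);
  plD : 'M[R]_(m, n);
  plE : 'M[R]_(l, d);
  plR : 'M[R]_d;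
  gam : R }.

Definition plant_ok (R : realType) (m d l n : nat) (S : plant R m d l n) :
    Prop :=
  [/\ (plE S)^T *m row_mx (plC S) (plE S) = row_mx 0 (plR S),
      posdef (plR S) & 0 < gam S].

Definition closed_loop (R : realType) (m d l n : nat) (S : plant R m d l n)
    (K : 'M[R]_(d, m)) : 'M[R]_m :=
  plA S - plB S *m K.

Definition stage_cost (R : realType) (m d l n : nat) (S : plant R m d l n)
    (K : 'M[R]_(d, m)) : 'M[R]_m :=
  (plC S)^T *m plC S + K^T *m plR S *m K.

Definition transfer (R : realType) (m d l n : nat) (S : plant R m d l n)
    (K : 'M[R]_(d, m)) (z : R[i]) : 'M[R[i]]_(m, n) :=
  map_mx (real_complex R) (sqrtmx (stage_cost S K))
  *m invmx (z%:M - map_mx (real_complex R) (closed_loop S K))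
  *m map_mx (real_complex R) (plD S).

Definition hinf_norm (R : realType) (m d l n : nat) (S : plant R m d l n)
    (K : 'M[R]_(d, m)) : \bar R :=
  ereal_sup
    [set (Num.sqrt (lambda_max
            ((transfer S K (expi (- t)))^T *m transfer S K (expi t))))%:E
    | t in `[0, 2 * pi[ ].

Definition feasible (R : realType) (m d l n : nat) (S : plant R m d l n)
    (K : 'M[R]_(d, m)) : Prop :=
  stable (closed_loop S K) /\ (hinf_norm S K < (gam S)%:E)%E.

Definition tilde (R : realType) (m d l n : nat) (S : plant R m d l n)
    (P : 'M[R]_m) : 'M[R]_m :=
  P + P *m plD S
      *m invmx ((gam S ^+ 2)%:M - (plD S)^T *m P *m plD S)
      *m (plD S)^T *m P.

Definition stabilizing_solution (R : realType) (m d l n : nat)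
    (S : plant R m d l n) (K : 'M[R]_(d, m)) (P : 'M[R]_m) : Prop :=
  [/\ (closed_loop S K)^T *m tilde S P *m closed_loop S K
        + stage_cost S K - P = 0,
      possemidef P,
      posdef (1%:M - gam S ^- 2 *: ((plD S)^T *m P *m plD S)) &
      stable ((invmx (1%:M - gam S ^- 2 *: (P *m plD S *m (plD S)^T)))^T
              *m closed_loop S K)].

(* For feasible [K] there is exactly one stabilizing solution (bounded real
   lemma); the default value 0 is only taken when there is none. *)
Definition ricP (R : realType) (m d l n : nat) (S : plant R m d l n)
    (K : 'M[R]_(d, m)) : 'M[R]_m :=
  xget 0 [set P | stabilizing_solution S K P].

Definition tildeP (R : realType) (m d l n : nat) (S : plant R m d l n)
    (K : 'M[R]_(d, m)) : 'M[R]_m :=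
  tilde S (ricP S K).

Definition gainG (R : realType) (m d l n : nat) (S : plant R m d l n)
    (K : 'M[R]_(d, m)) : 'M[R]_d :=
  plR S + (plB S)^T *m tildeP S K *m plB S.

Definition gradE (R : realType) (m d l n : nat) (S : plant R m d l n)
    (K : 'M[R]_(d, m)) : 'M[R]_(d, m) :=
  gainG S K *m K - (plB S)^T *m tildeP S K *m plA S.

Definition cost (R : realType) (m d l n : nat) (S : plant R m d l n)
    (K : 'M[R]_(d, m)) : R :=
  - gam S ^+ 2
  * ln (\det (1%:M - gam S ^- 2 *: (ricP S K *m plD S *m (plD S)^T))).

Definition global_optimum (R : realType) (m d l n : nat)
    (S : plant R m d l n) (K : 'M[R]_(d, m)) : Prop :=
  feasible S K /\ forall K', feasible S K' -> cost S K <= cost S K'.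

Definition natural_pg (R : realType) (m d l n : nat) (S : plant R m d l n)
    (eta : R) (K : nat -> 'M[R]_(d, m)) : Prop :=
  forall k, K k.+1 = K k - (2 * eta) *: gradE S (K k).

Definition gauss_newton (R : realType) (m d l n : nat) (S : plant R m d l n)
    (eta : R) (K : nat -> 'M[R]_(d, m)) : Prop :=
  forall k,
    K k.+1 = K k - (2 * eta) *: (invmx (gainG S (K k)) *m gradE S (K k)).

(* Main.v *)
Require Import Defs.
From HB Require Import structures.
From mathcomp Require Import all_boot all_order all_algebra.
From mathcomp Require Import all_classical all_reals all_analysis.
From mathcomp Require Import complex spectral.
From mathcomp Require Import ring lra.

(** The proof is a Lyapunov argument with the value matrix [P_K] itself as Lyapunov
function.  Completing the square shows that [tilde] of [P] is the value of one step of
a game in which the disturbance maximizes and pays [gamma^2 |w|^2]; the Riccati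
equation of [K] is the Bellman equation of this game.  For another gain [K'] the
one-step cost against [P_K] is [P_K] plus a quadratic polynomial in [K' - K] with
slope [E_K] and curvature [R + B^T tilde(P_K) B] ([update_cost]).  With the prescribed
stepsizes both iterations lower it by at least [c |E_K x|^2], where [c] does not
depend on the iterate ([natural_step], [gauss_newton_step]).

So [P_K] is a strict supersolution of the Riccati equation of [K'].  This keeps the
iteration in the feasible set: an unstable mode of the new closed loop would have to be
a mode of the old one ([slack_stable]), and at any frequency equality in the gain bound
would need zero slack and the worst-case disturbance, which the stability of the old
worst-case closed loop excludes uniformly ([slack_freq]).  Comparison with the
stabilizing solution of [K'] ([riccati_compare]) then yields
[P_K' + c E_K^T E_K <= P_K].  Hence the traces of the [P_K] decrease by at least
[c |E_K|_F^2] at each step and stay nonnegative, so the sum of the [|E_K|_F^2] is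
bounded; the curvature decreases with [P_K], so the stepsize bound at [K_0] persists.

Feasibility is a condition in the frequency domain, and the existence of [P_K] has to
be derived from it (the hard half of the bounded real lemma).  On a periodic trajectory
the discrete Parseval identity turns the frequency bound into an energy bound
([periodic_gain]); letting the period grow gives a gain bound on finite horizons
([time_gain]).  It bounds the finite-horizon values of the game, whose increasing limit
solves the Riccati equation ([riccati_solution]).  The solution is stabilizing because
the same game with a slightly smaller [gamma] still has a finite value
([bounded_real]).

Complex vectors are handled as pairs of real ones, so that all estimates concern real
quadratic forms; complex numbers occur only where eigenvalues and the transfer function
have to be related to such pairs. *)

Set Implicit Arguments.
Unset Strict Implicit.
Unset Printing Implicit Defensive.

Import Order.TTheory GRing.Theory Num.Theory.
Import numFieldNormedType.Exports.

Local Open Scope classical_set_scope.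
Local Open Scope ring_scope.

(** * Quadratic forms *)

Definition bl (R : realType) p q (M : 'M[R]_(p, q)) (x : 'cV[R]_p)
  (y : 'cV[R]_q) : R := (x^T *m M *m y) 0 0.

Notation qf M x := (bl M x x).
Notation sq x := (bl 1%:M x x).

Lemma unitmx_inj (F : fieldType) p (M : 'M[F]_p) :
  (forall x : 'cV_p, M *m x = 0 -> x = 0) -> M \in unitmx.
Proof.
move=> h; rewrite -unitmx_tr -row_free_unit; apply: inj_row_free => v vM.
apply: trmx_inj; rewrite trmx0; apply: h.
by rewrite -[M]trmxK -trmx_mul vM trmx0.
Qed.

Section Forms.
Context {R : realType}.
Implicit Types p q r : nat.

Lemma blDl p q (M : 'M[R]_(p, q)) x x' y : bl M (x + x') y = bl M x y + bl M x' y.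
Proof. by rewrite /bl linearD /= !mulmxDl mxE. Qed.

Lemma blDr p q (M : 'M[R]_(p, q)) x y y' : bl M x (y + y') = bl M x y + bl M x y'.
Proof. by rewrite /bl !mulmxDr mxE. Qed.

Lemma blZl p q (M : 'M[R]_(p, q)) a x y : bl M (a *: x) y = a * bl M x y.
Proof. by rewrite /bl linearZ /= -!scalemxAl mxE. Qed.

Lemma blZr p q (M : 'M[R]_(p, q)) a x y : bl M x (a *: y) = a * bl M x y.
Proof. by rewrite /bl -!scalemxAr mxE. Qed.

Lemma blNl p q (M : 'M[R]_(p, q)) x y : bl M (- x) y = - bl M x y.
Proof. by rewrite -scaleN1r blZl mulN1r. Qed.

Lemma blNr p q (M : 'M[R]_(p, q)) x y : bl M x (- y) = - bl M x y.
Proof. by rewrite -scaleN1r blZr mulN1r. Qed.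

Lemma bl0l p q (M : 'M[R]_(p, q)) y : bl M 0 y = 0.
Proof. by rewrite -(scale0r 0) blZl mul0r. Qed.

Lemma bl0r p q (M : 'M[R]_(p, q)) x : bl M x 0 = 0.
Proof. by rewrite -(scale0r 0) blZr mul0r. Qed.

Lemma bl_addm p q (M N : 'M[R]_(p, q)) x y : bl (M + N) x y = bl M x y + bl N x y.
Proof. by rewrite /bl mulmxDr mulmxDl mxE. Qed.

Lemma bl_scalem p q a (M : 'M[R]_(p, q)) x y : bl (a *: M) x y = a * bl M x y.
Proof. by rewrite /bl -scalemxAr -scalemxAl mxE. Qed.

Lemma bl_oppm p q (M : 'M[R]_(p, q)) x y : bl (- M) x y = - bl M x y.
Proof. by rewrite -scaleN1r bl_scalem mulN1r. Qed.

Lemma bl_0m p q x y : bl (0 : 'M[R]_(p, q)) x y = 0.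
Proof. by rewrite -(scale0r 0) bl_scalem mul0r. Qed.

Lemma bl_scalar p a (x y : 'cV[R]_p) : bl a%:M x y = a * bl 1%:M x y.
Proof. by rewrite -bl_scalem scalemx1. Qed.

Lemma bl_mulr p q r (M : 'M[R]_(p, q)) (A : 'M[R]_(q, r)) x y :
  bl M x (A *m y) = bl (M *m A) x y.
Proof. by rewrite /bl !mulmxA. Qed.

Lemma bl_mull p q r (M : 'M[R]_(p, q)) (A : 'M[R]_(p, r)) x y :
  bl M (A *m x) y = bl (A^T *m M) x y.
Proof. by rewrite /bl trmx_mul !mulmxA. Qed.

Lemma bl_tr p q (M : 'M[R]_(p, q)) x y : bl M^T y x = bl M x y.
Proof. by rewrite /bl -[in RHS](trmxK (x^T *m _ *m _)) [RHS]mxE !trmx_mul trmxK mulmxA. Qed.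

Lemma bl_sum p q (M : 'M[R]_(p, q)) x y :
  bl M x y = \sum_i \sum_j x i 0 * M i j * y j 0.
Proof.
rewrite /bl mxE exchange_big /=; apply: eq_bigr => j _.
by rewrite mxE mulr_suml; apply: eq_bigr => i _; rewrite !mxE.
Qed.

Lemma sq_sum p (x : 'cV[R]_p) : sq x = \sum_i x i 0 ^+ 2.
Proof. by rewrite /bl mulmx1 mxE; apply: eq_bigr => i _; rewrite !mxE. Qed.

Lemma sq_ge0 p (x : 'cV[R]_p) : 0 <= sq x.
Proof. by rewrite sq_sum sumr_ge0 // => i _; rewrite sqr_ge0. Qed.

Lemma sq_eq0 p (x : 'cV[R]_p) : sq x = 0 -> x = 0.
Proof.
rewrite sq_sum => /psumr_eq0P h; apply/matrixP => i j; rewrite ord1 mxE.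
by apply/eqP; rewrite -sqrf_eq0; apply/eqP/h => // k _; rewrite sqr_ge0.
Qed.

Lemma sq_gt0 p (x : 'cV[R]_p) : x != 0 -> 0 < sq x.
Proof.
by move=> x0; rewrite lt_def sq_ge0 andbT; apply: contra_neq x0; exact: sq_eq0.
Qed.

Lemma sq_mul p q (A : 'M[R]_(p, q)) x : sq (A *m x) = qf (A^T *m A) x.
Proof. by rewrite bl_mull bl_mulr mulmx1. Qed.

Lemma bl_delta p q (M : 'M[R]_(p, q)) i j :
  bl M (delta_mx i 0) (delta_mx j 0) = M i j.
Proof. by rewrite /bl trmx_delta -rowE -colE !mxE. Qed.

Lemma blC p (M : 'M[R]_p) x y : M^T = M -> bl M x y = bl M y x.
Proof. by move=> sM; rewrite -bl_tr sM. Qed.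

Lemma polarization p (M N : 'M[R]_p) : M^T = M -> N^T = N ->
  (forall x, qf M x = qf N x) -> M = N.
Proof.
move=> sM sN h; apply/matrixP => i j.
have := h (delta_mx i 0 + delta_mx j 0); rewrite !(blDl, blDr) !h.
rewrite (blC (delta_mx j 0) _ sM) (blC (delta_mx j 0) _ sN) !bl_delta.
by lra.
Qed.

(** A complex vector is handled as the pair of its real and imaginary parts;
multiplication by the complex number [a + ib] scales the Hermitian form
[qf M x + qf M y] of such a pair by [a^2 + b^2]. *)
Lemma qf_rot p (M : 'M[R]_p) a b x y :
  qf M (a *: x - b *: y) + qf M (b *: x + a *: y) =
  (a ^+ 2 + b ^+ 2) * (qf M x + qf M y).
Proof. by rewrite !(blDl, blDr, blNl, blNr, blZl, blZr); ring. Qed.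

Lemma sq_rot p a b (x y : 'cV[R]_p) :
  sq (a *: x - b *: y) + sq (b *: x + a *: y) =
  (a ^+ 2 + b ^+ 2) * (sq x + sq y).
Proof. exact: qf_rot. Qed.

Lemma qf_le_sum p (M : 'M[R]_p) x : qf M x <= (\sum_i \sum_j `|M i j|) * sq x.
Proof.
rewrite bl_sum mulr_suml; apply: ler_sum => i _.
rewrite mulr_suml; apply: ler_sum => j _.
have hc k : x k 0 ^+ 2 <= sq x.
  by rewrite sq_sum (bigD1 k) //= lerDl sumr_ge0 // => ? _; rewrite sqr_ge0.
apply: le_trans (ler_norm _) _; rewrite mulrAC normrM mulrC.
rewrite ler_wpM2l // normrM.
have := hc i; have := hc j; rewrite -(real_normK (num_real (x i 0))).
rewrite -(real_normK (num_real (x j 0))).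
by have := sqr_ge0 (`|x i 0| - `|x j 0|); rewrite sqrrB; lra.
Qed.

Lemma qf_bound p (M : 'M[R]_p) : exists2 c, 0 <= c & forall x, qf M x <= c * sq x.
Proof.
exists (\sum_i \sum_j `|M i j|); last exact: qf_le_sum.
by apply: sumr_ge0 => i _; apply: sumr_ge0.
Qed.

Lemma sq_mul_bound p q (A : 'M[R]_(p, q)) :
  exists2 c, 0 <= c & forall x, sq (A *m x) <= c * sq x.
Proof.
have [c c0 h] := qf_bound (A^T *m A).
by exists c => // x; rewrite sq_mul.
Qed.

Lemma sqD_le p (x y : 'cV[R]_p) : sq (x + y) <= 2 * sq x + 2 * sq y.
Proof.
have := sq_ge0 (x - y).
rewrite !(blDl, blDr, blNl, blNr) (@blC _ 1%:M y) ?trmx1 //; lra.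
Qed.

Definition psd p (M : 'M[R]_p) := forall x, 0 <= qf M x.

Lemma cauchy_schwarz p (M : 'M[R]_p) x y : M^T = M -> psd M ->
  bl M x y ^+ 2 <= qf M x * qf M y.
Proof.
move=> sM pM; set a := qf M x; set b := bl M x y; set c := qf M y.
have h s t : 0 <= s ^+ 2 * a + 2 * (s * t) * b + t ^+ 2 * c.
  have := pM (s *: x + t *: y).
  rewrite !(blDl, blDr, blZl, blZr) (blC y x sM) -/a -/b -/c.
  by congr (_ <= _); ring.
have a0 : 0 <= a := pM x; have c0 : 0 <= c := pM y.
have [cz|c_n0] := eqVneq c 0; last first.
  have cp : 0 < c by rewrite lt_def c_n0.
  have := h c (- b); rewrite -subr_ge0 => h1.
  rewrite -subr_ge0 -(pmulr_rge0 _ cp); move: h1.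
  by congr (_ <= _); ring.
rewrite cz mulr0.
have [-> |b0] := eqVneq b 0; first by rewrite expr0n.
have := h 1 (- (a + 1) / (2 * b)); rewrite cz mulr0 addr0.
have -> : 1 ^+ 2 * a + 2 * (1 * (- (a + 1) / (2 * b))) * b = -1.
  by field.
by rewrite oppr_ge0 ler10.
Qed.

Lemma symmxP p (M : 'M[R]_p) : M \is symmetricmx <-> M^T = M.
Proof.
rewrite is_hermitianmxE /= expr0 scale1r map_mx_id //.
by split=> [/eqP <-|->].
Qed.

Lemma posdef_sym p (M : 'M[R]_p) : posdef M -> M^T = M.
Proof. by case=> /symmxP. Qed.

Lemma posdef_psd p (M : 'M[R]_p) : posdef M -> psd M.
Proof.
case=> _ h x; have [->|x0] := eqVneq x 0; first by rewrite bl0l.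
by apply: ltW; exact: h.
Qed.

Lemma posdef_unit p (M : 'M[R]_p) : posdef M -> M \in unitmx.
Proof.
move=> [_ h]; apply: unitmx_inj => x Mx.
by apply/eqP; apply/negPn/negP => /h; rewrite -mulmxA Mx mulmx0 mxE ltxx.
Qed.

Lemma tr_invmx_sym p (M : 'M[R]_p) : M^T = M -> (invmx M)^T = invmx M.
Proof. by move=> sM; rewrite trmx_inv sM. Qed.

(** Cauchy-Schwarz for [M], applied to [x] and [M^-1 x], bounds the norm by the
form, so that compactness of the sphere is avoided. *)
Lemma posdef_coercive p (M : 'M[R]_p) : posdef M ->
  exists2 c, 0 <= c & forall x, sq x <= c * qf M x.
Proof.
move=> dM; have sM := posdef_sym dM; have pM := posdef_psd dM.
have uM := posdef_unit dM.
have [c c0 hc] := qf_bound (invmx M); exists c => // x.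
have [->|x0] := eqVneq x 0; first by rewrite !bl0l mulr0.
have := cauchy_schwarz (invmx M *m x) x sM pM.
rewrite !bl_mull !bl_mulr tr_invmx_sym // mulVmx // mul1mx => h.
rewrite -(ler_pM2l (sq_gt0 x0)) -expr2; apply: le_trans h _.
by rewrite mulrA [sq x * c]mulrC ler_wpM2r // hc.
Qed.

Lemma posdef_lb p (M : 'M[R]_p) e : M^T = M -> 0 < e ->
  (forall x, e * sq x <= qf M x) -> posdef M.
Proof.
move=> sM e0 h; split=> [|x x0]; first by apply/symmxP.
by apply: lt_le_trans (h x); rewrite mulr_gt0 // sq_gt0.
Qed.
End Forms.

(** * Stable matrices *)

Notation normc := ComplexField.Normc.normc.
Notation cplx A := (map_mx (real_complex _) A).
Notation mxRe x := (map_mx (@complex.Re _) x).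
Notation mxIm x := (map_mx (@complex.Im _) x).

(** The only form in which stability is used: geometric decay in the Euclidean norm,
a statement about real vectors. *)
Definition geom_stable (R : realType) m (A : 'M[R]_m) : Prop :=
  exists C r : R, [/\ 0 <= C, 0 <= r, r < 1 &
    forall k x, sq (iter k (mulmx A) x) <= C * r ^+ k * sq x].

Section Stability.
Context {R : realType}.
Implicit Types (z : R[i]) (m p : nat).

Lemma normc_ge0 z : 0 <= normc z.
Proof. by case: z => a b; exact: sqrtr_ge0. Qed.

Lemma ReD z z' : complex.Re (z + z') = complex.Re z + complex.Re z'.
Proof. by case: z z' => [? ?] []. Qed.

Lemma ImD z z' : complex.Im (z + z') = complex.Im z + complex.Im z'.
Proof. by case: z z' => [? ?] []. Qed.

Lemma mxRe_mul m p q (A : 'M[R]_(m, p)) (x : 'M[R[i]]_(p, q)) :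
  mxRe (cplx A *m x) = A *m mxRe x.
Proof.
apply/matrixP => i j; rewrite !mxE (big_morph _ ReD (erefl _)).
by apply: eq_bigr => k _; rewrite !mxE; case: (x k j) => u v /=; ring.
Qed.

Lemma mxIm_mul m p q (A : 'M[R]_(m, p)) (x : 'M[R[i]]_(p, q)) :
  mxIm (cplx A *m x) = A *m mxIm x.
Proof.
apply/matrixP => i j; rewrite !mxE (big_morph _ ImD (erefl _)).
by apply: eq_bigr => k _; rewrite !mxE; case: (x k j) => u v /=; ring.
Qed.

Lemma mxRe_scale p q a b (x : 'M[R[i]]_(p, q)) :
  mxRe (Complex a b *: x) = a *: mxRe x - b *: mxIm x.
Proof. by apply/matrixP => i j; rewrite !mxE; case: (x i j). Qed.

Lemma mxIm_scale p q a b (x : 'M[R[i]]_(p, q)) :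
  mxIm (Complex a b *: x) = b *: mxRe x + a *: mxIm x.
Proof. by apply/matrixP => i j; rewrite !mxE; case: (x i j) => u v /=; ring. Qed.

Lemma mxReD p q (x y : 'M[R[i]]_(p, q)) : mxRe (x + y) = mxRe x + mxRe y.
Proof. by apply/matrixP => i j; rewrite !mxE ReD. Qed.

Lemma mxImD p q (x y : 'M[R[i]]_(p, q)) : mxIm (x + y) = mxIm x + mxIm y.
Proof. by apply/matrixP => i j; rewrite !mxE ImD. Qed.

Lemma mxReIm0 p q (x : 'M[R[i]]_(p, q)) : mxRe x = 0 -> mxIm x = 0 -> x = 0.
Proof.
move=> /matrixP hr /matrixP hi; apply/matrixP => i j.
move: (hr i j) (hi i j); rewrite !mxE.
by case: (x i j) => u v /= -> ->.
Qed.

Lemma seq_norm_gap (s : seq R[i]) : (forall z, z \in s -> normc z < 1) ->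
  exists q : R, [/\ 0 < q, q < 1 & forall z, z \in s -> normc z < q].
Proof.
elim: s => [|z s IH] h; first by exists (1 / 2); split => //; lra.
have [|q [q0 q1 hq]] := IH; first by move=> w ws; apply: h; rewrite inE ws orbT.
have z1 : normc z < 1 by apply: h; rewrite inE eqxx.
exists (Num.max q ((normc z + 1) / 2)); split.
- by rewrite lt_max q0.
- by rewrite gt_max q1 /=; lra.
- move=> w; rewrite inE lt_max => /predU1P[->|/hq -> //].
  by apply/orP; right; lra.
Qed.

Lemma char_poly_closed m (A : 'M[R[i]]_m) :
  exists s, char_poly A = \prod_(z <- s) ('X - z%:P).
Proof.
have [s hs] := closed_field_poly_normal (char_poly A).
by exists s; rewrite hs (monicP (char_poly_monic A)) scale1r.
Qed.

Lemma eigen_in_roots m (A : 'M[R[i]]_m) s :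
  char_poly A = \prod_(z <- s) ('X - z%:P) ->
  forall z, eigenvalue A z = (z \in s).
Proof. by move=> h z; rewrite eigenvalue_root_char h root_prod_XsubC. Qed.

Lemma stable_eigen_lt1 m (A : 'M[R]_m) z :
  stable A -> eigenvalue (cplx A) z -> normc z < 1.
Proof.
move=> sA ez; apply: le_lt_trans sA; apply: ub_le_sup; last by exists z.
have [s /eigen_in_roots hs] := char_poly_closed (cplx A).
exists (\sum_(w <- s) normc w) => _ [w /= ws <-]; rewrite hs in ws.
rewrite (big_rem w) //= lerDl sumr_ge0 // => ? _; exact: normc_ge0.
Qed.

Lemma eigen_lt1_stable m (A : 'M[R]_m) :
  (forall z, eigenvalue (cplx A) z -> normc z < 1) -> stable A.
Proof.
move=> h; have [s /eigen_in_roots hs] := char_poly_closed (cplx A).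
have [q [q0 q1 hq]] : exists q : R,
    [/\ 0 < q, q < 1 & forall z, z \in s -> normc z < q].
  by apply: seq_norm_gap => z; rewrite -hs; exact: h.
rewrite /stable /spectral_radius; set E := (X in sup X).
have [->|/set0P E0] := eqVneq E set0; first by rewrite sup0.
apply: le_lt_trans q1; apply: ge_sup => // _ [z ez <-].
by apply/ltW/hq; rewrite -hs.
Qed.

Lemma normc_sqr a b : normc (Complex a b : R[i]) ^+ 2 = a ^+ 2 + b ^+ 2.
Proof. by rewrite /= sqr_sqrtr // addr_ge0 ?sqr_ge0. Qed.

Lemma geom_small (c r e : R) : 0 <= r -> r < 1 -> 0 < e ->
  exists N, forall k, (N <= k)%N -> c * r ^+ k <= e.
Proof.
move=> r0 r1 e0; have : c * r ^+ k @[k --> \oo] --> c * 0.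
  by apply: cvgM; [exact: cvg_cst|apply: cvg_expr]; rewrite ger0_norm.
by rewrite mulr0 => /cvgr_le/(_ _ e0)[N _ hN]; exists N => k /hN.
Qed.

Lemma le0_geom (c r e : R) : 0 <= r -> r < 1 ->
  (forall k, e <= c * r ^+ k) -> e <= 0.
Proof.
move=> r0 r1 h; rewrite leNgt; apply/negP => e0.
have [|N hN] := @geom_small c r (e / 2) r0 r1; first by rewrite divr_gt0.
by have := hN N (leqnn N); have := h N; lra.
Qed.

(** Eigenvalues are defined by complex row vectors; a square matrix that kills a row
vector also kills a column vector, whose two real parts form the pair. *)
Lemma stable_of_pairs m (A : 'M[R]_m) :
  (forall a b (x y : 'cV[R]_m), A *m x = a *: x - b *: y -> A *m y = b *: x + a *: y ->
     1 <= a ^+ 2 + b ^+ 2 -> x = 0 /\ y = 0) -> stable A.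
Proof.
move=> h; apply: eigen_lt1_stable => z /eigenvalueP[v vA v0].
rewrite ltNge; apply/negP => z1; case/negP: v0; apply/eqP.
have u : cplx A - z%:M \in unitmx.
  apply: unitmx_inj => x; rewrite mulmxBl mul_scalar_mx => /subr0_eq.
  case: z {vA} z1 => a b z1 e.
  have [|||? ?] := h a b (mxRe x) (mxIm x); last exact: mxReIm0.
  - by rewrite -mxRe_mul e mxRe_scale.
  - by rewrite -mxIm_mul e mxIm_scale.
  - by rewrite -normc_sqr exprn_ege1.
rewrite -[v](mulmxK u) mulmxBr vA mul_mx_scalar subrr mul0mx //.
Qed.

Lemma geom_pairs m (A : 'M[R]_m) a b (x y : 'cV[R]_m) : geom_stable A ->
  A *m x = a *: x - b *: y -> A *m y = b *: x + a *: y ->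
  1 <= a ^+ 2 + b ^+ 2 -> x = 0 /\ y = 0.
Proof.
move=> [C [r [C0 r0 r1 h]]] hx hy ab.
have e k : sq (iter k (mulmx A) x) + sq (iter k (mulmx A) y) =
    (a ^+ 2 + b ^+ 2) ^+ k * (sq x + sq y).
  suff [-> ->] : iter k (mulmx A) x = complex.Re (Complex a b ^+ k) *: x
     - complex.Im (Complex a b ^+ k) *: y /\
     iter k (mulmx A) y = complex.Im (Complex a b ^+ k) *: x
     + complex.Re (Complex a b ^+ k) *: y.
    rewrite sq_rot; congr (_ * _).
    elim: k => [|k IH]; first by rewrite !expr0 /=; ring.
    rewrite [RHS]exprS -IH (exprS (Complex a b)); case: (Complex a b ^+ k) => u v /=; ring.
  elim: k => [|k [IHx IHy]]; first by rewrite expr0 /= !scale1r !scale0r subr0 add0r.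
  rewrite !iterS IHx IHy exprS; case: (Complex a b ^+ k) => u v /=.
  rewrite !(mulmxDr, mulmxN) -!scalemxAr hx hy.
  by split; apply/matrixP => i j; rewrite !mxE; ring.
suff : sq x + sq y <= 0.
  by have := sq_ge0 x; have := sq_ge0 y => *; split; apply: sq_eq0; lra.
have le k : sq x + sq y <= C * (sq x + sq y) * r ^+ k.
  have := h k x; have := h k y; have := e k.
  have : sq x + sq y <= (a ^+ 2 + b ^+ 2) ^+ k * (sq x + sq y).
    by rewrite ler_peMl ?addr_ge0 ?sq_ge0 // exprn_ege1.
  by lra.
exact: le0_geom le.
Qed.

(** If [f (k+1) = z * f k + u k] with [u] decaying at a rate [q] above the modulus of
[z], then [f] decays at the same rate; the factors [A - z] are peeled off one by one. *)
Lemma iter_mulmx_entries m p (A : 'M[R[i]]_m) (q : R) s (v : 'M[R[i]]_(m, p)) :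
  0 < q -> (forall z, z \in s -> normc z < q) ->
  foldl (fun v z => A *m v - z *: v) v s = 0 ->
  exists2 c, 0 <= c & forall k i j, normc (iter k (mulmx A) v i j) <= c * q ^+ k.
Proof.
move=> q0; elim: s v => [|z s IH] v hs /= hv.
  exists 0 => // k i j; suff -> : iter k (mulmx A) v = 0.
    by rewrite mxE ComplexField.Normc.normc0 mul0r.
  by elim: k => [//|k IHk]; rewrite iterS IHk mulmx0.
have [|c c0 hc] := IH _ _ hv; first by move=> w ws; apply: hs; rewrite inE ws orbT.
have zq : normc z < q by apply: hs; rewrite inE eqxx.
(* the first term absorbs the forcing, the second one the initial value *)
pose c1 := c / (q - normc z) + \sum_i \sum_j normc (v i j).
have s0 : 0 <= \sum_i \sum_j normc (v i j).
  by do 2!apply: sumr_ge0 => ? _; exact: normc_ge0.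
have c2 : c <= c1 * (q - normc z).
  rewrite mulrDl divfK ?subr_eq0 ?gt_eqF // lerDl mulr_ge0 // subr_ge0.
  exact: ltW.
have c1_0 : 0 <= c1 by rewrite addr_ge0 // divr_ge0 // subr_ge0 ltW.
exists c1 => // k i j; elim: k => [|k IHk].
  rewrite mulr1 /=; apply: (@le_trans _ _ (\sum_i \sum_j normc (v i j))).
    rewrite (bigD1 i) //= (bigD1 j) //= -addrA lerDl addr_ge0 //.
      by apply: sumr_ge0 => ? _; exact: normc_ge0.
    by do 2!apply: sumr_ge0 => ? _; exact: normc_ge0.
  by rewrite lerDr divr_ge0 // subr_ge0 ltW.
have -> : iter k.+1 (mulmx A) v =
    z *: iter k (mulmx A) v + iter k (mulmx A) (A *m v - z *: v).
  rewrite -[LHS]/(A *m _); elim: k {IHk} => [|k IHk /=]; first by rewrite /= addrC subrK.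
  by rewrite {1}IHk mulmxDr -scalemxAr.
rewrite [_ i j]mxE [in X in X + _]mxE.
apply: le_trans (le_normcD _ _) _; rewrite ComplexField.Normc.normcM.
have := hc k i j; have := ler_wpM2l (normc_ge0 z) IHk.
have := ler_wpM2r (exprn_ge0 k (ltW q0)) c2.
rewrite exprS; lra.
Qed.

Lemma foldl_horner m p (A : 'M[R[i]]_m.+1) s (v : 'M[R[i]]_(m.+1, p)) :
  foldl (fun v z => A *m v - z *: v) v s =
  horner_mx A (\prod_(z <- s) ('X - z%:P)) *m v.
Proof.
elim: s v => [|z s IH] v; first by rewrite big_nil rmorph1 mul1mx.
rewrite big_cons mulrC rmorphM /= IH -[RHS]mulmxA; congr (_ *m _).
by rewrite rmorphB /= horner_mx_X horner_mx_C mulmxBl mul_scalar_mx.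
Qed.

Lemma iter_mulmxE m p q (A : 'M[R]_m) (v : 'M[R]_(m, p)) (x : 'M[R]_(p, q)) k :
  iter k (mulmx A) (v *m x) = iter k (mulmx A) v *m x.
Proof. by elim: k => //= k ->; rewrite mulmxA. Qed.

(** By Cayley-Hamilton the factors [A - z], over the eigenvalues [z], compose to
zero; removing one factor at a time, the orbit solves a first order recurrence
with ratio [z], so it decays at any rate above all the moduli. *)
Lemma stable_geom m (A : 'M[R]_m) : stable A -> geom_stable A.
Proof.
case: m A => [|m] A sA.
  exists 0, 0; split => // k x.
  by rewrite !sq_sum !big_ord0 mulr0.
have [s hs] := char_poly_closed (cplx A).
have [q [q0 q1 hq]] : exists q : R,
    [/\ 0 < q, q < 1 & forall z, z \in s -> normc z < q].
  by apply: seq_norm_gap => z; rewrite -(eigen_in_roots hs); exact: stable_eigen_lt1.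
have [|c c0 hc] := @iter_mulmx_entries _ _ (cplx A) q s 1%:M q0 hq.
  by rewrite foldl_horner -hs Cayley_Hamilton mul0mx.
have hE k i j : `|iter k (mulmx A) 1%:M i j| <= c * q ^+ k.
  apply: le_trans (hc k i j).
  suff -> : iter k (mulmx (cplx A)) 1%:M = cplx (iter k (mulmx A) 1%:M).
    by rewrite mxE /= expr0n addr0 sqrtr_sqr.
  by elim: k => /= [|k ->]; rewrite ?map_mx1 // map_mxM.
exists (\sum_(i < m.+1) \sum_(j < m.+1) \sum_(k < m.+1) c ^+ 2), (q ^+ 2).
split.
- by do 3!apply: sumr_ge0 => ? _; rewrite sqr_ge0.
- by rewrite sqr_ge0.
- by rewrite expr_lt1 // ltW.
move=> k x; rewrite -[in iter k _ x](mul1mx x) iter_mulmxE sq_mul.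
apply: le_trans (qf_le_sum _ _) _; rewrite ler_wpM2r ?sq_ge0 //.
rewrite mulr_suml; apply: ler_sum => i _; rewrite mulr_suml.
apply: ler_sum => j _; rewrite mulr_suml mxE.
apply: le_trans (ler_norm_sum _ _ _) _; apply: ler_sum => l _.
rewrite mxE normrM exprAC -exprMn expr2.
by apply: ler_pM => //; exact: hE.
Qed.

Lemma geom_of_pairs m (A : 'M[R]_m) :
  (forall a b (x y : 'cV[R]_m), A *m x = a *: x - b *: y -> A *m y = b *: x + a *: y ->
     1 <= a ^+ 2 + b ^+ 2 -> x = 0 /\ y = 0) -> geom_stable A.
Proof. by move=> h; apply/stable_geom/stable_of_pairs. Qed.

End Stability.

(** * Hermitian forms and the square root *)

Notation cadj M := (map_mx Num.conj M^T).

Section Hermitian.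
Context {R : realType}.
Implicit Types (z : R[i]) (m p q : nat).

Definition hsq p (u : 'cV[R[i]]_p) : R := sq (mxRe u) + sq (mxIm u).

Lemma hsq_ge0 p (u : 'cV[R[i]]_p) : 0 <= hsq u.
Proof. by rewrite addr_ge0 ?sq_ge0. Qed.

Lemma hsq_eq0 p (u : 'cV[R[i]]_p) : hsq u = 0 -> u = 0.
Proof.
have := sq_ge0 (mxRe u); have := sq_ge0 (mxIm u); rewrite /hsq => h1 h2 h.
by apply: mxReIm0; apply: sq_eq0; lra.
Qed.

Lemma cadj_mulE p (u v : 'cV[R[i]]_p) : (cadj u *m v) 0 0 =
  Complex (bl 1%:M (mxRe u) (mxRe v) + bl 1%:M (mxIm u) (mxIm v))
          (bl 1%:M (mxRe u) (mxIm v) - bl 1%:M (mxIm u) (mxRe v)).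
Proof.
have dotE (x y : 'cV[R]_p) : bl 1%:M x y = \sum_i x i 0 * y i 0.
  by rewrite /bl mulmx1 mxE; apply: eq_bigr => i _; rewrite mxE.
have eRe (f : 'I_p -> R[i]) : complex.Re (\sum_i f i) = \sum_i complex.Re (f i).
  exact: (big_morph _ ReD).
have eIm (f : 'I_p -> R[i]) : complex.Im (\sum_i f i) = \sum_i complex.Im (f i).
  exact: (big_morph _ ImD).
apply/eqP; rewrite mxE eq_complex eRe eIm !dotE -big_split -sumrB /=.
apply/andP; split; apply/eqP; apply: eq_bigr => i _; rewrite !mxE;
  by case: (u i 0) (v i 0) => [a b] [c d] /=; ring.
Qed.

Lemma cadj_mul_self p (u : 'cV[R[i]]_p) : (cadj u *m u) 0 0 = real_complex R (hsq u).
Proof. by rewrite cadj_mulE (blC (mxIm u)) ?trmx1 // subrr. Qed.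

Lemma cadjM p q r (A : 'M[R[i]]_(p, q)) (B : 'M[R[i]]_(q, r)) :
  cadj (A *m B) = cadj B *m cadj A.
Proof. by rewrite trmx_mul map_mxM. Qed.

Lemma cadjK p q (A : 'M[R[i]]_(p, q)) : cadj (cadj A) = A.
Proof. exact: trmxCK. Qed.

Lemma cadj_cplx p q (A : 'M[R]_(p, q)) : cadj (cplx A) = cplx A^T.
Proof. by apply/matrixP => i j; rewrite !mxE; apply/eqP; rewrite eq_complex /= oppr0 !eqxx. Qed.

Lemma form_cplx p (Q : 'M[R]_p) (u : 'cV[R[i]]_p) : Q^T = Q ->
  (cadj u *m cplx Q *m u) 0 0 = real_complex R (qf Q (mxRe u) + qf Q (mxIm u)).
Proof.
move=> sQ; rewrite -mulmxA cadj_mulE mxRe_mul mxIm_mul !bl_mulr !mul1mx.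
by rewrite (blC (mxIm u) (mxRe u) sQ) subrr.
Qed.

(** The row eigenvector in the definition of an eigenvalue of [T^* T], read as a
column vector. *)
Lemma gram_eigen p q (T : 'M[R[i]]_(p, q)) z : eigenvalue (cadj T *m T) z ->
  exists u : 'cV[R[i]]_q, 0 < hsq u /\ z = real_complex R (hsq (T *m u) / hsq u).
Proof.
case/eigenvalueP => w wM w0; pose u := cadj w; exists u.
have u0 : 0 < hsq u.
  rewrite lt_def hsq_ge0 andbT; apply: contra_neq w0 => /hsq_eq0 hu.
  by rewrite -[w]cadjK -/u hu trmx0 map_mx0.
split=> //; rewrite rmorphM fmorphV /=.
have u1 : (hsq u)%:C%C != 0 by rewrite fmorph_eq0 gt_eqF.
have ew : cadj u = w by rewrite cadjK.
rewrite mulmxA in wM.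
apply: (mulIf u1); rewrite divfK // -!cadj_mul_self cadjM ew mulmxA.
by rewrite wM -scalemxAl [in RHS]mxE.
Qed.

Lemma spectral_eigen (p : nat) (M : 'M[R[i]]_p) i : M \is normalmx ->
  eigenvalue M (spectral_diag M 0 i).
Proof.
move=> /orthomx_spectralP eM; apply/eigenvalueP; exists (row i (spectralmx M)).
  rewrite -row_mul {2}eM !mulmxA mulmxV ?spectral_unit // mul1mx.
  by rewrite row_mul row_diag_mx -scalemxAl -rowE.
apply/eqP => h; have := spectral_unit M; rewrite -row_free_unit => /row_freeP[B hB].
have := congr1 (row i) hB; rewrite row_mul h mul0mx => /rowP/(_ i)/eqP.
by rewrite !mxE eqxx eq_sym oner_eq0.
Qed.

(** In an orthonormal eigenbasis the form is a combination of eigenvalues with weights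
the squared moduli of the coordinates. *)
Lemma gram_form_le p q (T : 'M[R[i]]_(p, q)) (c : R) :
  (forall x : R, eigenvalue (cadj T *m T) x%:C%C -> x <= c) ->
  forall u, hsq (T *m u) <= c * hsq u.
Proof.
move=> h u; set M := cadj T *m T.
have nM : M \is normalmx by apply/normalmxP; rewrite /M !cadjM !cadjK.
have := nM => /orthomx_spectralP eM.
have U := spectral_unitarymx M; set P := spectralmx M in eM U.
have e1 : real_complex R (hsq (T *m u)) =
    \sum_i spectral_diag M 0 i * (cadj (P *m u) 0 i * (P *m u) i 0).
  rewrite -cadj_mul_self cadjM mulmxA -[_ *m _ *m T]mulmxA -/M [in LHS]eM.
  rewrite invmx_unitary // !mulmxA -cadjM -[_ *m P *m u]mulmxA mul_mx_diag mxE.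
  by apply: eq_bigr => i _; rewrite [X in X * _]mxE; ring.
have e2 : real_complex R (hsq u) = \sum_i cadj (P *m u) 0 i * (P *m u) i 0.
  rewrite -cadj_mul_self; suff -> : cadj u *m u = cadj (P *m u) *m (P *m u) by rewrite mxE.
  rewrite cadjM -mulmxA [cadj P *m _]mulmxA -invmx_unitary //.
  by rewrite mulVmx ?unitarymx_unit // mul1mx.
have : (hsq (T *m u))%:C%C <= (c * hsq u)%:C%C; last by rewrite lecR.
rewrite rmorphM /= e1 e2 mulr_sumr; apply: ler_sum => i _.
rewrite ler_wpM2r //.
  by rewrite [X in X * _]mxE [_^T _ _]mxE mulrC mul_conjC_ge0.
have E := spectral_eigen i nM; have [v [_ ev]] := gram_eigen E.
by rewrite ev lecR; apply: h; rewrite -ev.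
Qed.

Lemma interpolation (s : seq R) (f : R -> R) :
  exists p : {poly R}, forall x, x \in s -> p.[x] = f x.
Proof.
elim: s => [|x s [p hp]]; first by exists 0.
have [xs|xs] := boolP (x \in s).
  by exists p => y; rewrite inE => /predU1P[->|]; exact: hp.
pose g := \prod_(y <- s) ('X - y%:P).
have gx : g.[x] != 0 by rewrite -/(root g x) root_prod_XsubC.
exists (p + ((f x - p.[x]) / g.[x]) *: g) => y; rewrite inE hornerD hornerZ.
case/predU1P => [->|ys]; first by rewrite divfK // addrC subrK.
have -> : g.[y] = 0 by apply/rootP; rewrite root_prod_XsubC.
by rewrite mulr0 addr0 hp.
Qed.

Lemma tr_horner_mx p (A : 'M[R]_p.+1) (f : {poly R}) :
  (horner_mx A f)^T = horner_mx A^T f.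
Proof.
elim/poly_ind: f => [|f c IH]; first by rewrite !rmorph0 trmx0.
rewrite !rmorphD !rmorphM /= !horner_mx_X !horner_mx_C linearD /= tr_scalar_mx.
congr (_ + _); rewrite [LHS]trmx_mul IH; apply: comm_mx_horner.
exact: comm_mx_refl.
Qed.

Lemma horner_mx_diag_fix (F : fieldType) p (P : 'M[F]_p.+1) (sp : 'rV[F]_p.+1) f :
  P \in unitmx -> (forall i, f.[sp 0 i] = sp 0 i) ->
  horner_mx (invmx P *m diag_mx sp *m P) f = invmx P *m diag_mx sp *m P.
Proof.
move=> uP hf; rewrite horner_mx_uconjC // horner_mx_diag.
by congr (_ *m diag_mx _ *m _); apply/rowP => i; rewrite mxE.
Qed.

Lemma horner_mx_normal p (M : 'M[R[i]]_p.+1) (f : {poly R[i]}) : M \is normalmx ->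
  (forall i, f.[spectral_diag M 0 i] = spectral_diag M 0 i) -> horner_mx M f = M.
Proof.
move=> /orthomx_spectralP eM hf.
have := horner_mx_diag_fix (spectral_unit M) hf.
by rewrite -eM.
Qed.

(** A polynomial interpolating the fourth root on the spectrum turns a positive
semidefinite matrix into a symmetric fourth root, whose square is the wanted
square root; this keeps the entries real although the diagonalization is complex. *)
Lemma possemidef_sqrt_ex p (Q : 'M[R]_p) : possemidef Q ->
  exists S, possemidef S /\ S *m S = Q.
Proof.
case: p Q => [|p] Q [sQ pQ].
  by exists Q; split; [split|rewrite [Q]flatmx0 mul0mx].
have {}sQ : Q^T = Q by apply/symmxP.
pose M := cplx Q; have nM : M \is normalmx by apply/normalmxP; rewrite cadj_cplx sQ.
have hsp i : exists2 a : R, 0 <= a & spectral_diag M 0 i = real_complex R a.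
  case/eigenvalueP: (spectral_eigen i nM) => w wM w0; pose u := cadj w.
  have u0 : 0 < hsq u.
    rewrite lt_def hsq_ge0 andbT; apply: contra_neq w0 => /hsq_eq0 hu.
    by rewrite -[w]cadjK -/u hu trmx0 map_mx0.
  exists ((qf Q (mxRe u) + qf Q (mxIm u)) / hsq u).
    by rewrite divr_ge0 ?(ltW u0) // addr_ge0 //; exact: pQ.
  rewrite rmorphM fmorphV /=.
  have u1 : (hsq u)%:C%C != 0 by rewrite fmorph_eq0 gt_eqF.
  apply: (mulIf u1); rewrite divfK // -(form_cplx u sQ) -cadj_mul_self /u cadjK.
  by rewrite wM -scalemxAl [in RHS]mxE.
pose xs := [seq complex.Re (spectral_diag M 0 i) | i <- enum 'I_p.+1].
have [f hf] := interpolation xs (fun x => Num.sqrt (Num.sqrt x)).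
have f4 : horner_mx Q (f ^+ 4) = Q.
  apply: (map_mx_inj (f := real_complex R)).
  rewrite map_horner_mx; apply: (horner_mx_normal nM) => i.
  have [a a0 ea] := hsp i; rewrite ea horner_map /= horner_exp hf; last first.
    by apply/mapP; exists i; rewrite ?mem_enum // ea.
  by rewrite -[4%N]/(2 * 2)%N exprM !sqr_sqrtr ?sqrtr_ge0.
pose S0 := horner_mx Q f.
have sS0 : S0^T = S0 by rewrite tr_horner_mx sQ.
exists (S0 *m S0); split; last first.
  by rewrite -[in RHS]f4 rmorphXn /= !exprS expr0 mulr1 -!mulmxE !mulmxA.
split; first by apply/symmxP; rewrite trmx_mul sS0.
move=> x; rewrite -[_ 0 0]/(qf (S0 *m S0) x) -{1}sS0 -sq_mul; exact: sq_ge0.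
Qed.

Lemma sqrtmxP p (Q : 'M[R]_p) : possemidef Q ->
  (sqrtmx Q)^T *m sqrtmx Q = Q.
Proof.
move=> /possemidef_sqrt_ex /(xgetPex 0) [[/symmxP sS _] eS].
by rewrite /sqrtmx sS.
Qed.
End Hermitian.

(** * The H-infinity norm as a bound on sinusoidal responses *)

(** The real form of [|Q^(1/2) (zI - A)^-1 D|^2 <= b] at [z = e^(it)]: the pairs
[(x, y)] and [(u, v)] are the complex amplitudes of state and input, and rotation by
the angle [t] is multiplication by [z]. *)
Definition freq_bound (R : realType) m n (A : 'M[R]_m) (D : 'M[R]_(m, n))
    (Q : 'M[R]_m) (b : R) : Prop :=
  forall t x y u v, 0 <= t < 2 * pi ->
    A *m x + D *m u = cos t *: x - sin t *: y ->
    A *m y + D *m v = sin t *: x + cos t *: y ->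
    qf Q x + qf Q y <= b * (sq u + sq v).

Section Transfer.
Context {R : realType} {m d l n : nat}.
Variables (S : plant R m d l n) (K : 'M[R]_(d, m)).
Hypothesis hS : plant_ok S.

Let A := closed_loop S K.
Let D := plD S.
Let Q := stage_cost S K.

Lemma stage_costE x : qf Q x = sq (plC S *m x) + qf (plR S) (K *m x).
Proof. by rewrite /Q /stage_cost bl_addm sq_mul [in X in _ = _ + X]bl_mull bl_mulr. Qed.

Lemma stage_cost_psd : possemidef Q.
Proof.
have [_ dR _] := hS; split.
  by apply/symmxP; rewrite linearD /= !trmx_mul !trmxK (posdef_sym dR) mulmxA.
move=> x; rewrite -[_ 0 0]/(qf Q x) stage_costE addr_ge0 ?sq_ge0 //.
exact: posdef_psd.
Qed.

Lemma circle_unit t : geom_stable A -> (expi t)%:M - cplx A \in unitmx.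
Proof.
move=> gA; apply: unitmx_inj => x; rewrite mulmxBl mul_scalar_mx.
move=> /subr0_eq e.
have [|||? ?] := @geom_pairs _ _ A (cos t) (sin t) (mxRe x) (mxIm x) gA;
  last exact: mxReIm0.
- by rewrite -mxRe_mul -e mxRe_scale.
- by rewrite -mxIm_mul -e mxIm_scale.
- by rewrite cos2Dsin2.
Qed.

Lemma transfer_adj t : (transfer S K (expi (- t)))^T = cadj (transfer S K (expi t)).
Proof.
rewrite -map_trmx; congr (_^T); rewrite /transfer !map_mxM map_invmx /=.
have gen (C : fieldType) p q r (X X' : 'M[C]_(p, q)) (Y Y' : 'M[C]_q)
    (Z Z' : 'M[C]_(q, r)) : X = X' -> Y = Y' -> Z = Z' ->
    X *m invmx Y *m Z = X' *m invmx Y' *m Z' by move=> -> -> ->.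
apply: gen; apply/matrixP => i j; rewrite !mxE.
- by rewrite [RHS]conjc_real.
- rewrite /expi cosN sinN; case: (i == j); apply/eqP;
  by rewrite eq_complex /= ?mulr1n ?mulr0n /=; apply/andP; split; apply/eqP; ring.
- by rewrite [RHS]conjc_real.
Qed.

Lemma transfer_energy t u : geom_stable A ->
  exists x y, [/\ A *m x + D *m mxRe u = cos t *: x - sin t *: y,
    A *m y + D *m mxIm u = sin t *: x + cos t *: y &
    hsq (transfer S K (expi t) *m u) = qf Q x + qf Q y].
Proof.
move=> gA; have U := circle_unit t gA.
pose z := invmx ((expi t)%:M - cplx A) *m (cplx D *m u).
have ez : expi t *: z = cplx A *m z + cplx D *m u.
  rewrite -mul_scalar_mx; apply/eqP; rewrite addrC -subr_eq -mulmxBl.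
  by rewrite mulmxA mulmxV // mul1mx.
exists (mxRe z), (mxIm z); split.
- by rewrite -!mxRe_mul -mxReD -ez mxRe_scale.
- by rewrite -!mxIm_mul -mxImD -ez mxIm_scale.
- rewrite /transfer -!mulmxA -/z /hsq mxRe_mul mxIm_mul !sq_mul.
  by rewrite sqrtmxP //; exact: stage_cost_psd.
Qed.

(** The spectral theorem turns the bound on the largest eigenvalue of [T^* T] into a
bound on the Hermitian form, which is the output energy. *)
Lemma hinf_lt_freq : geom_stable A -> (hinf_norm S K < (gam S)%:E)%E ->
  exists2 b, 0 <= b < gam S ^+ 2 & freq_bound A D Q b.
Proof.
move=> gA; rewrite /hinf_norm; set E := ereal_sup _ => hE.
have ubE t : 0 <= t < 2 * pi -> ((Num.sqrt (lambda_max
    ((transfer S K (expi (- t)))^T *m transfer S K (expi t))))%:E <= E)%E.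
  by move=> ht; apply: ereal_sup_ubound; exists t => //=; rewrite in_itv.
have [b eb b0] : exists2 b : R, E = b%:E & 0 <= b.
  have t0 : 0 <= (0 : R) < 2 * pi by rewrite lexx /= mulr_gt0 // pi_gt0.
  have := le_trans (_ : (0%:E <= _)%E) (ubE _ t0).
  move=> /(_ (sqrtr_ge0 _)); case: E {ubE} hE => [b| |] //= _.
  by rewrite lee_fin => b0; exists b.
rewrite eb lte_fin in hE; exists (b ^+ 2).
  by rewrite sqr_ge0 /= ltr_pXn2r // nnegrE // ltW // (le_lt_trans b0).
move=> t x y u v ht ex ey.
have := ubE _ ht; rewrite eb lee_fin transfer_adj; set T := transfer _ _ _ => hb.
have lb : lambda_max (cadj T *m T) <= b ^+ 2.
  have [L0|L0] := leP 0 (lambda_max (cadj T *m T)); last first.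
    by apply: le_trans (ltW L0) _; rewrite sqr_ge0.
  by rewrite -(sqr_sqrtr L0) ler_pXn2r // nnegrE sqrtr_ge0.
pose w := cplx u + 'i%C *: cplx v.
have wR : mxRe w = u by apply/matrixP => i j; rewrite !mxE /=; ring.
have wI : mxIm w = v by apply/matrixP => i j; rewrite !mxE /=; ring.
have [x' [y' [ex' ey' eT]]] := transfer_energy t w gA.
rewrite wR in ex'; rewrite wI in ey'.
have [e1 e2] : x - x' = 0 /\ y - y' = 0.
  apply: (@geom_pairs _ _ A (cos t) (sin t)) => //; last by rewrite cos2Dsin2.
  - rewrite mulmxBr -[A *m x](addrK (D *m u)) ex.
    rewrite -[A *m x'](addrK (D *m u)) ex'.
    by apply/matrixP => i j; rewrite !mxE; ring.
  - rewrite mulmxBr -[A *m y](addrK (D *m v)) ey.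
    rewrite -[A *m y'](addrK (D *m v)) ey'.
    by apply/matrixP => i j; rewrite !mxE; ring.
rewrite (subr0_eq e1) (subr0_eq e2) -eT.
have -> : sq u + sq v = hsq w by rewrite /hsq wR wI.
apply: gram_form_le => a ea; apply: le_trans lb; apply: ub_le_sup => //.
have [s hs] := char_poly_closed (cadj T *m T).
exists (\sum_(z <- s) normc z) => r /= er.
rewrite (eigen_in_roots hs) in er; rewrite (big_rem _ er) /=.
apply: (@le_trans _ _ (normc (r%:C%C))).
  by rewrite /= expr0n addr0 sqrtr_sqr ler_norm.
by rewrite lerDl sumr_ge0 // => ? _; exact: normc_ge0.
Qed.

(** The converse needs only the energy of an eigenvector. *)
Lemma freq_hinf_lt b : geom_stable A -> 0 <= b < gam S ^+ 2 ->
  freq_bound A D Q b -> (hinf_norm S K < (gam S)%:E)%E.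
Proof.
move=> gA /andP[b0 bg] fb; have [_ _ g0] := hS.
apply: (@le_lt_trans _ _ (Num.sqrt b)%:E); last first.
  by rewrite lte_fin -(ltr_pXn2r (n := 2)) ?nnegrE ?sqrtr_ge0 ?ltW // sqr_sqrtr.
apply: ge_ereal_sup => _ [t /= ht <-]; rewrite in_itv /= in ht.
rewrite lee_fin ler_sqrt // transfer_adj /lambda_max.
set T := transfer _ _ _; set E := (X in sup X).
have [->|/set0P E0] := eqVneq E set0; first by rewrite sup0.
apply: ge_sup => // x /gram_eigen[u [u0 /complexI ->]].
have [x' [y' [ex ey eT]]] := transfer_energy t u gA.
by rewrite ler_pdivrMr // eT; apply: fb ht ex ey.
Qed.
End Transfer.

(** * From frequency to time *)

Section Fourier.
Context {R : realType}.

Lemma cos_natpi k : cos (k%:R * (2 * pi) : R) = 1 /\ sin (k%:R * (2 * pi) : R) = 0.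
Proof.
elim: k => [|k [c s]]; first by rewrite mul0r cos0 sin0.
have e : k.+1%:R * (2 * pi) = k%:R * (2 * pi) + pi *+ 2 :> R.
  by rewrite -natr1 -mulr_natl; ring.
by rewrite e (cosD (_ * _)) (sinD (_ * _)) c s cos2pi sin2pi; split; ring.
Qed.

(** Multiplied by [2 sin (a / 2)] the sum telescopes. *)
Lemma sum_cos_roots (N j : nat) : (0 < j < N)%N ->
  \sum_(k < N) cos (k%:R * (j%:R * (2 * pi / N%:R)) : R) = 0.
Proof.
move=> /andP[j0 jN]; have N0 : (0 < N%:R :> R) by rewrite ltr0n (leq_ltn_trans _ jN).
set a := j%:R * _.
have s0 : 0 < sin (a / 2).
  apply: sin_gt0_pi; apply/andP; split.
    by rewrite divr_gt0 // mulr_gt0 ?ltr0n // divr_gt0 // mulr_gt0 // pi_gt0.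
  have -> : a / 2 = pi * (j%:R / N%:R) by rewrite /a; field; rewrite gt_eqF.
  by rewrite gtr_pMr ?pi_gt0 // ltr_pdivrMr // mul1r ltr_nat.
have tele M : 2 * sin (a / 2) * \sum_(k < M) cos (k%:R * a) =
    sin (M%:R * a - a / 2) + sin (a / 2).
  elim: M => [|M IH]; first by rewrite big_ord0 mul0r sub0r sinN; ring.
  rewrite big_ord_recr mulrDr IH /=.
  have -> : M.+1%:R * a - a / 2 = M%:R * a + a / 2 by rewrite -natr1; field.
  by rewrite sinB sinD; ring.
have := tele N; have -> : N%:R * a - a / 2 = - (a / 2) + j%:R * (2 * pi).
  by rewrite /a; field; rewrite gt_eqF.
have [c s] := cos_natpi j; rewrite sinD c s sinN => /eqP.
rewrite mulr1 mulr0 addr0 addNr !mulf_eq0 pnatr_eq0 /= (gt_eqF s0) /=.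
by move/eqP.
Qed.

Lemma bl_suml p q (M : 'M[R]_(p, q)) (N : nat) (f : 'I_N -> R) (x : 'I_N -> 'cV[R]_p) y :
  bl M (\sum_i f i *: x i) y = \sum_i f i * bl M (x i) y.
Proof.
rewrite (big_morph (fun v => bl M v y) (fun a b => blDl M a b y) (bl0l M y)).
by apply: eq_bigr => i _; rewrite blZl.
Qed.

Lemma bl_sumr p q (M : 'M[R]_(p, q)) (N : nat) (f : 'I_N -> R) (x : 'I_N -> 'cV[R]_q) y :
  bl M y (\sum_i f i *: x i) = \sum_i f i * bl M y (x i).
Proof.
rewrite (big_morph (fun v => bl M y v) (fun a b => blDr M y a b) (bl0r M y)).
by apply: eq_bigr => i _; rewrite blZr.
Qed.

(** Real and imaginary parts of the discrete Fourier transform of a real sequence. *)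
Definition dftcos p N (x : nat -> 'cV[R]_p) k :=
  \sum_(s < N) cos (k%:R * (s%:R * (2 * pi / N%:R))) *: x s.
Definition dftsin p N (x : nat -> 'cV[R]_p) k :=
  - \sum_(s < N) sin (k%:R * (s%:R * (2 * pi / N%:R))) *: x s.

Lemma parseval p N (Q : 'M[R]_p) x :
  \sum_(k < N) (qf Q (dftcos N x k) + qf Q (dftsin N x k)) =
  N%:R * \sum_(s < N) qf Q (x s).
Proof.
pose ph (k s : nat) : R := k%:R * (s%:R * (2 * pi / N%:R)).
have e (k : 'I_N) : qf Q (dftcos N x k) + qf Q (dftsin N x k) =
    \sum_(s < N) \sum_(r < N) cos (ph k s - ph k r) * bl Q (x s) (x r).
  rewrite blNl blNr opprK !bl_suml -big_split; apply: eq_bigr => s _ /=.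
  rewrite !bl_sumr !mulr_sumr -big_split; apply: eq_bigr => r _ /=.
  by rewrite cosB /ph; ring.
under eq_bigr do rewrite e.
rewrite exchange_big mulr_sumr; apply: eq_bigr => s _ /=.
rewrite exchange_big (bigD1 s) //= [X in _ + X]big1 => [|r rs].
  rewrite addr0; under eq_bigr do rewrite subrr cos0 mul1r.
  by rewrite sumr_const card_ord mulr_natl.
rewrite -mulr_suml; set T := \sum_(_ < N) _; suff -> : T = 0 by rewrite mul0r.
have [sr|sr|/val_inj e1] := ltngtP s r; last by rewrite e1 eqxx in rs.
- rewrite -(@sum_cos_roots N (r - s)).
    apply: eq_bigr => k _; rewrite -cosN natrB ?(ltnW sr) // /ph; congr cos; ring.
  by rewrite subn_gt0 sr (leq_ltn_trans (leq_subr _ _)).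
- rewrite -(@sum_cos_roots N (s - r)).
    apply: eq_bigr => k _; rewrite natrB ?(ltnW sr) // /ph; congr cos; ring.
  by rewrite subn_gt0 sr (leq_ltn_trans (leq_subr _ _)).
Qed.

Lemma sum_shift (V : zmodType) N (g : nat -> V) : g N = g 0%N ->
  \sum_(s < N) g s.+1 = \sum_(s < N) g s.
Proof.
move=> h; apply/eqP; rewrite -subr_eq0 -sumrB.
have -> : \sum_(s < N) (g s.+1 - g s) = g N - g 0%N.
  by rewrite -telescope_sumr // big_mkord.
by rewrite h subrr.
Qed.
End Fourier.

Section Gain.
Context {R : realType} {m n : nat}.
Variables (A : 'M[R]_m) (D : 'M[R]_(m, n)) (Q : 'M[R]_m).

(** A periodic trajectory is a superposition of sinusoidal ones at the roots of
unity, and Parseval's identity adds up their energies. *)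
Lemma periodic_gain b N (x : nat -> 'cV[R]_m) (w : nat -> 'cV[R]_n) :
  freq_bound A D Q b -> (0 < N)%N ->
  (forall s, (s < N)%N -> x s.+1 = A *m x s + D *m w s) -> x N = x 0%N ->
  \sum_(s < N) qf Q (x s) <= b * \sum_(s < N) sq (w s).
Proof.
move=> fb N0 hx xN; have NR : 0 < N%:R :> R by rewrite ltr0n.
rewrite -(ler_pM2l NR) -parseval mulrCA -parseval mulr_sumr.
apply: ler_sum => k _; pose th : R := k%:R * (2 * pi / N%:R).
have phE s : k%:R * (s%:R * (2 * pi / N%:R)) = s%:R * th :> R by rewrite /th; ring.
have [cN sN] : cos (N%:R * th) = 1 /\ sin (N%:R * th) = 0.
  by rewrite (_ : N%:R * th = k%:R * (2 * pi)) ?cos_natpi //; [exact: cos_natpi|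
    rewrite /th; field; rewrite gt_eqF].
apply: (fb th).
- apply/andP; split.
    by rewrite mulr_ge0 // divr_ge0 ?(ltW NR) // mulr_ge0 // pi_ge0.
  have -> : th = (2 * pi) * (k%:R / N%:R) by rewrite /th; ring.
  by rewrite gtr_pMr ?mulr_gt0 ?pi_gt0 // ltr_pdivrMr // mul1r ltr_nat.
- pose g s := (cos th * cos (s%:R * th) + sin th * sin (s%:R * th)) *: x s.
  transitivity (\sum_(s < N) g s.+1).
    rewrite !mulmx_sumr -big_split; apply: eq_bigr => s _ /=.
    rewrite -!scalemxAr -scalerDr -hx // phE /g -[s.+1%:R]natr1.
    by congr (_ *: _); rewrite -[LHS]cosN -cosB; congr cos; ring.
  rewrite sum_shift; last first.
    by rewrite /g xN cN sN mul0r cos0 sin0.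
  rewrite scalerN opprK !scaler_sumr -big_split; apply: eq_bigr => s _ /=.
  by rewrite phE !scalerA -scalerDl.
- pose g s := (sin th * cos (s%:R * th) - cos th * sin (s%:R * th)) *: x s.
  transitivity (\sum_(s < N) g s.+1).
    rewrite !mulmxN -opprD !mulmx_sumr -big_split -sumrN; apply: eq_bigr => s _ /=.
    rewrite -!scalemxAr -scalerDr -hx // phE /g -[s.+1%:R]natr1 -scaleNr.
    by congr (_ *: _); rewrite -sinB -sinN; congr sin; ring.
  rewrite sum_shift; last first.
    by rewrite /g xN cN sN mul0r cos0 sin0.
  rewrite scalerN !scaler_sumr -sumrB; apply: eq_bigr => s _ /=.
  by rewrite phE !scalerA -scalerBl.
Qed.

Fixpoint state (x : 'cV[R]_m) (w : nat -> 'cV[R]_n) s : 'cV[R]_m :=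
  if s is s'.+1 then A *m state x w s' + D *m w s' else x.

Lemma state_shift x w s :
  state x w s.+1 = state (A *m x + D *m w 0%N) (w \o S) s.
Proof.
elim: s => [//|s IH].
by rewrite -[LHS]/(A *m state x w s.+1 + D *m w s.+1) IH.
Qed.

Lemma state_eq x w w' t s : (forall r, (r < t)%N -> w r = w' r) -> (s <= t)%N ->
  state x w s = state x w' s.
Proof. by move=> h; elim: s => //= s IH st; rewrite h // IH // ltnW. Qed.

Notation pow k x := (iter k (mulmx A) x).

Lemma powD k (x y : 'cV[R]_m) : pow k (x + y) = pow k x + pow k y.
Proof. by elim: k => //= k ->; rewrite mulmxDr. Qed.

Lemma powN k (x : 'cV[R]_m) : pow k (- x) = - pow k x.
Proof. by elim: k => //= k ->; rewrite mulmxN. Qed.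

Lemma young del (x y : 'cV[R]_m) : Q^T = Q -> psd Q -> 0 < del ->
  qf Q (x - y) <= (1 + del) * qf Q x + (1 + del^-1) * qf Q y.
Proof.
move=> sQ pQ d0; have := pQ (del *: x + y).
rewrite !(blDl, blDr, blNl, blNr, blZl, blZr) (blC y x sQ) => h.
rewrite -subr_ge0 -(pmulr_rge0 _ d0); move: h; congr (_ <= _); field.
exact: lt0r_neq0.
Qed.

(** A finite stretch of input is extended by zero and made periodic.  As the period
grows, the initial state of the periodic response tends to zero, so that on the
stretch the given trajectory differs from it by a free motion started almost at [x];
the strict inequality [b < g] pays for the mixed terms. *)
Lemma time_gain b g : geom_stable A -> Q^T = Q -> psd Q -> freq_bound A D Q b ->
  0 <= b -> b < g ->
  exists c e, [/\ 0 <= c, 0 < e & forall t x w,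
    \sum_(s < t) qf Q (state x w s) - g * \sum_(s < t) sq (w s) <=
    c * sq x - e * \sum_(s < t) sq (w s)].
Proof.
move=> [C [r [C0 r0 r1 hA]]] sQ pQ fb b0 bg.
have [cQ cQ0 hQ] := qf_bound Q.
(* small enough for (1 + del) * b <= g - (g - b) / 2 *)
pose del := (g - b) / (2 * (b + 1)).
have d0 : 0 < del by rewrite divr_gt0 ?subr_gt0 // mulr_gt0 // ltr_wpDl.
pose Kc := (1 + del^-1) * (cQ * C / (1 - r)).
have dV : 0 <= 1 + del^-1 by rewrite addr_ge0 // invr_ge0 ltW.
have Kc0 : 0 <= Kc.
  by rewrite mulr_ge0 // divr_ge0 ?subr_ge0 ?(ltW r1) // mulr_ge0.
exists (2 * Kc), ((g - b) / 2); split; [by rewrite mulr_ge0|by lra|].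
move=> t x w; set W := \sum_(s < t) sq (w s).
have W0 : 0 <= W by apply: sumr_ge0 => s _; exact: sq_ge0.
suff main : \sum_(s < t) qf Q (state x w s) - (1 + del) * b * W - 2 * Kc * sq x <= 0.
  have : (1 + del) * b <= g - (g - b) / 2.
    have -> : (1 + del) * b = b + (g - b) / 2 * (b / (b + 1)).
      by rewrite /del; field; rewrite gt_eqF // ltr_wpDl.
    have : b / (b + 1) <= 1 by rewrite ler_pdivrMr ?ltr_wpDl // mul1r lerDl.
    have : 0 < (g - b) / 2 by lra.
    by move=> h1 /(ler_wpM2l (ltW h1)); lra.
  by move/(ler_wpM2r W0); lra.
have [k0 hk0] := @geom_small R C r (1 / 4) r0 r1 ltac:(lra).
pose y := state x w t - pow t x.
apply: (@le0_geom R (8 * Kc * C * r ^+ k0 * sq y) r _ r0 r1) => k.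
pose N := (t + (k0 + k).+1)%N.
have N0 : (0 < N)%N by rewrite /N addnS.
have hN z : sq (pow N z) <= 1 / 4 * sq z.
  apply: le_trans (hA N z) _; rewrite ler_wpM2r ?sq_ge0 //.
  by apply: hk0; rewrite /N addnS addnCA -addnS leq_addr.
(* [I - A^N] is invertible because [A^N] contracts *)
pose M := 1%:M - pow N 1%:M.
have ME z : M *m z = z - pow N z.
  by rewrite mulmxBl mul1mx -iter_mulmxE mul1mx.
have uM : M \in unitmx.
  apply: unitmx_inj => z; rewrite ME => /subr0_eq ez; apply: sq_eq0.
  by have := hN z; rewrite -ez; have := sq_ge0 z; lra.
(* the input is switched off after time [t] until the period [N] is complete *)
pose w' s := if (s < t)%N then w s else 0.
pose p := state x w' N - pow N x.
(* the initial state of the periodic trajectory with input [w'] *)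
pose xi := invmx M *m p.
have exi : xi = pow N xi + p.
  by apply/eqP; rewrite addrC -subr_eq -ME /xi mulmxA mulmxV // mul1mx.
have stt : state x w' t = state x w t.
  by apply: (@state_eq _ _ _ t) => // i it; rewrite /w' it.
have ep : p = pow (k0 + k).+1 y.
  have st i : state x w' (t + i) = pow i (state x w t).
    elim: i => [|i IH]; first by rewrite addn0 stt.
    by rewrite addnS /= IH /w' ltnNge leq_addr mulmx0 addr0.
  have eN : pow N x = pow (k0 + k).+1 (pow t x) by rewrite -iterD addnC.
  by rewrite /p eN st /y powD powN.
have sp : sq p <= C * r ^+ k0 * r ^+ k * sq y.
  rewrite ep; apply: le_trans (hA _ _) _; rewrite ler_wpM2r ?sq_ge0 //.
  rewrite -mulrA -exprD ler_wpM2l // exprS -[leRHS]mul1r ler_wpM2r ?exprn_ge0 //.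
  exact: ltW.
have sxi : sq xi <= 4 * sq p.
  by have := sqD_le (pow N xi) p; rewrite -exi; have := hN xi; lra.
pose dd := xi - x.
have sdd : sq dd <= 2 * sq x + 8 * sq p.
  have := sqD_le xi (- x); rewrite [sq (- x)]blNl blNr opprK /dd; lra.
pose xh s := state x w' s + pow s dd.
have pg : \sum_(s < N) qf Q (xh s) <= b * \sum_(s < N) sq (w' s).
  apply: periodic_gain fb N0 _ _ => [s sN|].
    by rewrite /xh /= mulmxDr addrAC.
  rewrite /xh /dd powD powN /= addrC addrAC -addrA -/p -exi.
  by rewrite addrCA subrr addr0.
have split_sum (f : nat -> R) : \sum_(s < N) f s =
   \sum_(s < t) f s + \sum_(t <= s < N) f s.
  by rewrite -!(big_mkord xpredT f) -big_cat_nat //= /N leq_addr.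
have ew : \sum_(s < N) sq (w' s) = W.
  rewrite (split_sum (fun s => sq (w' s))) [X in _ + X]big_nat_cond [X in _ + X]big1 ?addr0.
    by apply: eq_bigr => s _; rewrite /w' ltn_ord.
  by move=> s /andP[/andP[ts _] _]; rewrite /w' ltnNge ts bl0l.
have pg1 : \sum_(s < t) qf Q (xh s) <= b * W.
  rewrite -ew; apply: le_trans pg; rewrite (split_sum (fun s => qf Q (xh s))).
  by rewrite lerDl; apply: sumr_ge0 => s _; exact: pQ.
have geo u : \sum_(s < u) r ^+ s <= 1 / (1 - r).
  rewrite ler_pdivlMr ?subr_gt0 // mulrC.
  have := subrX1 r u; have : 0 <= r ^+ u by exact: exprn_ge0.
  by lra.
have free : \sum_(s < t) qf Q (pow s dd) <= cQ * C / (1 - r) * sq dd.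
  apply: (@le_trans _ _ (\sum_(s < t) cQ * C * sq dd * r ^+ s)).
    apply: ler_sum => s _; apply: le_trans (hQ _) _.
    by have := ler_wpM2l cQ0 (hA s dd); congr (_ <= _); ring.
  rewrite -mulr_sumr; have h0 : 0 <= cQ * C * sq dd by rewrite !mulr_ge0 ?sq_ge0.
  by have := ler_wpM2l h0 (geo t); congr (_ <= _); ring.
have : \sum_(s < t) qf Q (state x w s) <=
    (1 + del) * \sum_(s < t) qf Q (xh s) + (1 + del^-1) * \sum_(s < t) qf Q (pow s dd).
  rewrite !mulr_sumr -big_split; apply: ler_sum => s _ /=.
  have -> : state x w s = xh s - pow s dd.
    rewrite /xh addrK; apply: (@state_eq _ _ _ t); last by rewrite ltnW.
    by move=> i it; rewrite /w' it.
  exact: young.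
have := ler_wpM2l (addr_ge0 ler01 (ltW d0)) pg1.
have := ler_wpM2l dV free.
have := ler_wpM2l Kc0 sdd; rewrite /Kc.
have := ler_wpM2l Kc0 sp; rewrite /Kc; lra.
Qed.
End Gain.

(** * The Riccati equation *)

Section Riccati.
Context {R : realType} {m n : nat}.
Implicit Types (P Q A F : 'M[R]_m).

Section Game.
Variables (g : R) (D : 'M[R]_(m, n)).

Definition margin P : 'M[R]_n := g%:M - D^T *m P *m D.

Definition gtilde P : 'M[R]_m := P + P *m D *m invmx (margin P) *m D^T *m P.

Definition worst P : 'M[R]_(n, m) := invmx (margin P) *m D^T *m P.

Lemma margin_sym P : P^T = P -> (margin P)^T = margin P.
Proof. by move=> sP; rewrite linearB /= tr_scalar_mx !trmx_mul trmxK sP mulmxA. Qed.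

Lemma marginE P w : qf (margin P) w = g * sq w - qf P (D *m w).
Proof. by rewrite bl_addm bl_oppm bl_scalar [qf P _]bl_mull bl_mulr. Qed.

Lemma gtilde_sym P : P^T = P -> (gtilde P)^T = gtilde P.
Proof.
move=> sP; rewrite linearD /= !trmx_mul trmxK tr_invmx_sym ?margin_sym //.
by rewrite sP !mulmxA.
Qed.

(** Completing the square in the disturbance: [gtilde] is the value of a one-step
problem with terminal cost [P], and [worst] the maximizing disturbance. *)
Lemma complete_square P y w : P^T = P -> margin P \in unitmx ->
  qf P (y + D *m w) - g * sq w =
  qf (gtilde P) y - qf (margin P) (w - worst P *m y).
Proof.
move=> sP uP; have sG := margin_sym sP.
have GW : margin P *m worst P = D^T *m P by rewrite /worst -mulmxA mulKVmx.
have e1 : bl (margin P) w (worst P *m y) = bl P (D *m w) y.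
  by rewrite bl_mulr GW bl_mull.
have e2 : qf (margin P) (worst P *m y) = qf (gtilde P) y - qf P y.
  rewrite bl_mulr GW bl_mull bl_addm addrC addKr; congr (bl _ _ _).
  by rewrite /worst !trmx_mul trmxK tr_invmx_sym // sP !mulmxA.
rewrite !(blDl (margin P), blDr (margin P), blNl, blNr) e2 (blC (worst P *m y) w sG) e1.
by rewrite marginE blDl !blDr (blC y _ sP); ring.
Qed.

Section Posdef.
Variable P : 'M[R]_m.
Hypotheses (sP : P^T = P) (dP : posdef (margin P)).

Lemma game_le y w : qf P (y + D *m w) - g * sq w <= qf (gtilde P) y.
Proof.
rewrite complete_square // ?posdef_unit // lerBlDr lerDl.
exact: posdef_psd.
Qed.

Lemma game_eq y :
  qf P (y + D *m (worst P *m y)) - g * sq (worst P *m y) = qf (gtilde P) y.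
Proof. by rewrite complete_square // ?posdef_unit // subrr bl0l subr0. Qed.

Lemma gtilde_ge y : qf P y <= qf (gtilde P) y.
Proof. by have := game_le y 0; rewrite mulmx0 addr0 bl0l mulr0 subr0. Qed.
End Posdef.

Lemma gtilde_mono P P' : P^T = P -> P'^T = P' ->
  posdef (margin P) -> posdef (margin P') ->
  (forall x, qf P x <= qf P' x) -> forall y, qf (gtilde P) y <= qf (gtilde P') y.
Proof.
move=> sP sP' dP dP' h y; rewrite -game_eq //.
by apply: le_trans (game_le sP' dP' y (worst P *m y)); rewrite lerD2r.
Qed.
End Game.

Lemma cvg_sum (I : Type) (s : seq I) (f : I -> nat -> R) (l : I -> R) :
  (forall i, f i @ \oo --> l i) ->
  (fun t => \sum_(i <- s) f i t) @ \oo --> \sum_(i <- s) l i.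
Proof.
move=> h; elim: s => [|i s IH].
  by rewrite big_nil; under eq_fun do rewrite big_nil; exact: cvg_cst.
by rewrite big_cons; under eq_fun do rewrite big_cons; apply: cvgD.
Qed.

(** By polarization the entries are combinations of values of the form, so that they
converge as soon as the values of the form do. *)
Lemma monotone_limit p (V : nat -> 'M[R]_p) c : (forall t, (V t)^T = V t) ->
  (forall t x, qf (V t) x <= qf (V t.+1) x) -> (forall t x, qf (V t) x <= c * sq x) ->
  exists P : 'M[R]_p, [/\ P^T = P, forall t x, qf (V t) x <= qf P x &
    forall x a, (forall t, qf (V t) x <= a) -> qf P x <= a].
Proof.
move=> sV mV bV.
have ndV x : nondecreasing_seq (fun t => qf (V t) x).
  by apply/nondecreasing_seqP => t; exact: mV.
have cvV x : cvgn (fun t => qf (V t) x).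
  apply: nondecreasing_is_cvgn => //; exists (c * sq x) => _ [t _ <-].
  exact: bV.
have cvE i j : cvgn (fun t => V t i j).
  have e : (fun t => V t i j) =
     (fun t => 2^-1 * (qf (V t) (delta_mx i 0 + delta_mx j 0)
        - qf (V t) (delta_mx i 0) - qf (V t) (delta_mx j 0))).
    apply/funext => t; rewrite !(blDl, blDr) (blC (delta_mx j 0) _ (sV t)).
    by rewrite !bl_delta; field.
  rewrite e; apply: is_cvgM; first exact: is_cvg_cst.
  apply: is_cvgB; first by apply: is_cvgB; exact: cvV.
  exact: cvV.
pose P : 'M[R]_p := \matrix_(i, j) limn (fun t => V t i j).
have cvP x : (fun t => qf (V t) x) @ \oo --> qf P x.
  have -> : (fun t => qf (V t) x) =
      (fun t => \sum_i \sum_j x i 0 * V t i j * x j 0).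
    by apply/funext => t; rewrite bl_sum.
  rewrite bl_sum; apply: cvg_sum => i; apply: cvg_sum => j.
  by apply: cvgM; [apply: cvgM|]; try exact: cvg_cst; rewrite mxE; exact: cvE.
have limP x : limn (fun t => qf (V t) x) = qf P x by exact/cvg_lim.
exists P; split.
- apply/matrixP => i j; rewrite !mxE; congr (limn _); apply/funext => t.
  by rewrite -[in LHS](sV t) mxE.
- by move=> t x; rewrite -limP; exact: nondecreasing_cvgn_le.
- by move=> x a h; rewrite -limP; apply: limr_le => //; near=> t; exact: h.
Unshelve. all: by end_near.
Qed.

Lemma riccatiE (A Gt Q P : 'M[R]_m) z :
  A^T *m Gt *m A + Q = P -> qf P z = qf Gt (A *m z) + qf Q z.
Proof. by move=> <-; rewrite bl_addm [in RHS]bl_mull bl_mulr. Qed.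

Section ValueIteration.
Variables (g : R) (A : 'M[R]_m) (D : 'M[R]_(m, n)) (Q : 'M[R]_m).

Notation state := (state A D).

Definition payoff t x w : R :=
  \sum_(s < t) qf Q (state x w s) - g * \sum_(s < t) sq (w s).

Lemma payoff_shift t x w : payoff t.+1 x w =
  qf Q x - g * sq (w 0%N) + payoff t (A *m x + D *m w 0%N) (w \o S).
Proof.
rewrite /payoff !big_ord_recl /=.
under eq_bigr do rewrite -[X in bl Q X X]/(state x w _.+1) state_shift.
ring.
Qed.

Definition cons_seq (w0 : 'cV[R]_n) (w : nat -> 'cV[R]_n) s :=
  if s is s'.+1 then w s' else w0.

Lemma payoff_cons t x w0 w : payoff t.+1 x (cons_seq w0 w) =
  qf Q x - g * sq w0 + payoff t (A *m x + D *m w0) w.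
Proof. by rewrite payoff_shift. Qed.

Lemma payoff_eq t x w w' : (forall s, (s < t)%N -> w s = w' s) ->
  payoff t x w = payoff t x w'.
Proof.
move=> h; rewrite /payoff; congr (_ - _ * _); apply: eq_bigr => s _.
  by rewrite (@state_eq _ _ _ _ _ _ _ w' t) // ltnW.
by rewrite h.
Qed.

Variables (c e : R).
Hypotheses (sQ : Q^T = Q) (pQ : psd Q) (e0 : 0 < e).
Hypothesis gain : forall t x w,
  payoff t x w <= c * sq x - e * \sum_(s < t) sq (w s).

Definition iterate t : 'M[R]_m := iter t (fun P => A^T *m gtilde g D P *m A + Q) 0.

(** From rest, the disturbance [w] followed by an optimal input for the remaining
steps pays [- qf (margin g D _) w], and the gain hypothesis makes this at most
[- e * sq w]. *)
Lemma margin_lb t : (forall x, exists w, qf (iterate t) x = payoff t x w) ->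
  forall w, e * sq w <= qf (margin g D (iterate t)) w.
Proof.
move=> h w; rewrite marginE.
have [w' ew'] := h (D *m w); have := gain t.+1 0 (cons_seq w w').
rewrite payoff_cons mulmx0 add0r bl0l -ew' big_ord_recl /= bl0l mulr0.
have : 0 <= \sum_(i < t) sq (w' i) by apply: sumr_ge0 => i _; exact: sq_ge0.
by move=> /(mulr_ge0 (ltW e0)); lra.
Qed.

(** Dynamic programming: completing the square at each step shows that the iterate
is the maximum of the payoff, provided the margin of the previous one is positive. *)
Lemma iterateP t : [/\ (iterate t)^T = iterate t,
  forall x w, payoff t x w <= qf (iterate t) x,
  forall x, exists w, qf (iterate t) x = payoff t x w &
  forall w, e * sq w <= qf (margin g D (iterate t)) w].
Proof.
suff H : [/\ (iterate t)^T = iterate t,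
  forall x w, payoff t x w <= qf (iterate t) x &
  forall x, exists w, qf (iterate t) x = payoff t x w].
  by have [h1 h2 h3] := H; split=> //; exact: margin_lb.
elim: t => [|t [h1 h2 h3]].
  have p0 x w : payoff 0 x w = 0 by rewrite /payoff !big_ord0 mulr0 subr0.
  split=> [|x w|x]; first exact: trmx0.
    by rewrite p0 bl_0m.
  by exists (fun=> 0); rewrite p0 bl_0m.
have dM : posdef (margin g D (iterate t)).
  apply: (@posdef_lb _ _ _ e) => //; first exact: margin_sym.
  exact: margin_lb.
have qS x : qf (iterate t.+1) x = qf (gtilde g D (iterate t)) (A *m x) + qf Q x.
  exact: riccatiE.
split.
- by rewrite /= linearD /= !trmx_mul trmxK gtilde_sym // sQ mulmxA.
- move=> x w; rewrite payoff_shift qS.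
  have := game_le h1 dM (A *m x) (w 0%N); have := h2 (A *m x + D *m w 0%N) (w \o S).
  by lra.
- move=> x; set w0 := worst g D (iterate t) *m (A *m x).
  have [w ew] := h3 (A *m x + D *m w0); exists (cons_seq w0 w).
  by rewrite payoff_cons -ew qS -(game_eq h1 dM); ring.
Qed.

Lemma iterate_mono t x : qf (iterate t) x <= qf (iterate t.+1) x.
Proof.
have [_ _ /(_ x)[w ->] _] := iterateP t; have [_ up _ _] := iterateP t.+1.
pose w' s := if (s < t)%N then w s else 0.
apply: le_trans (up x w'); rewrite (@payoff_eq _ _ w w'); last first.
  by move=> s st; rewrite /w' st.
have w't : w' t = 0 by rewrite /w' ltnn.
rewrite /payoff !big_ord_recr /= w't bl0l addr0.
by have := pQ (state x w' t); lra.
Qed.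

(** The limit of the iterates inherits the Bellman equation from the supremum
characterization of its values; no continuity of the matrix inverse is involved. *)
Lemma riccati_solution : exists P, [/\ P^T = P /\ psd P,
  posdef (margin g D P), A^T *m gtilde g D P *m A + Q = P,
  (forall t x w, payoff t x w <= qf P x) &
  forall x a, (forall t w, payoff t x w <= a) -> qf P x <= a].
Proof.
have sV t : (iterate t)^T = iterate t by have [] := iterateP t.
have upV t x w : payoff t x w <= qf (iterate t) x.
  by have [_ h _ _] := iterateP t; exact: h.
have exV t x : exists w, qf (iterate t) x = payoff t x w.
  by have [_ _ h _] := iterateP t; exact: h.
have [|P [sP leP supP]] := @monotone_limit m iterate c sV iterate_mono.
  move=> t x; have [w ->] := exV t x; apply: le_trans (gain t x w) _.
  rewrite gerBl mulr_ge0 //; first exact: ltW.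
  by apply: sumr_ge0 => s _; exact: sq_ge0.
have upP t x w : payoff t x w <= qf P x by exact: le_trans (upV _ _ _) (leP _ _).
have pP : psd P by move=> x; have := leP 0%N x; rewrite bl_0m.
have dP : posdef (margin g D P).
  apply: (@posdef_lb _ _ _ e) => // [|w]; first exact: margin_sym.
  suff : qf P (D *m w) <= (g - e) * sq w by rewrite marginE; lra.
  apply: supP => t; have [_ _ _ /(_ w)] := iterateP t; rewrite marginE; lra.
have qS x : qf (A^T *m gtilde g D P *m A + Q) x =
    qf (gtilde g D P) (A *m x) + qf Q x.
  exact: riccatiE.
exists P; split=> //; last first.
  by move=> x a h; apply: supP => t; have [w ->] := exV t x; exact: h.
apply: polarization => //.
  by rewrite linearD /= !trmx_mul trmxK gtilde_sym // sQ mulmxA.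
move=> x; rewrite qS; apply/eqP; rewrite eq_le; apply/andP; split.
  rewrite -(game_eq sP dP); set w0 := worst g D P *m (A *m x).
  suff : qf P (A *m x + D *m w0) <= qf P x - qf Q x + g * sq w0 by lra.
  apply: supP => t; have [w ->] := exV t (A *m x + D *m w0).
  by have := upP t.+1 x (cons_seq w0 w); rewrite payoff_cons; lra.
apply: supP => t; have [w ->] := exV t x; case: t => [|t].
  rewrite /payoff !big_ord0 mulr0 subr0 addr_ge0 //.
  by apply: le_trans (gtilde_ge sP dP _).
rewrite payoff_shift; have := upP t (A *m x + D *m w 0%N) (w \o S).
by have := game_le sP dP (A *m x) (w 0%N); lra.
Qed.
End ValueIteration.

Definition closed_worst g A D P : 'M[R]_m := A + D *m (worst g D P *m A).

Lemma closed_worstE g A (D : 'M[R]_(m, n)) P (x : 'cV[R]_m) :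
  closed_worst g A D P *m x = A *m x + D *m (worst g D P *m (A *m x)).
Proof. by rewrite mulmxDl !mulmxA. Qed.

(** Bounded real lemma: lowering the level to [g'] only increases the value, and
along the worst-case closed loop the difference of the two values decreases by at
least [g - g'] times the disturbance energy.  An unstable mode would therefore be
driven by no disturbance at all, hence be a mode of [A]. *)
Lemma bounded_real g A (D : 'M[R]_(m, n)) Q b : geom_stable A -> Q^T = Q -> psd Q ->
  freq_bound A D Q b -> 0 <= b < g ->
  exists P, [/\ P^T = P, psd P, posdef (margin g D P),
    A^T *m gtilde g D P *m A + Q = P & geom_stable (closed_worst g A D P)].
Proof.
move=> gA sQ pQ fb /andP[b0 bg]; pose g' := (b + g) / 2.
have [bg' gg'] : b < g' /\ g' < g by rewrite /g'; split; lra.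
have [c [e [_ e0 gain']]] := time_gain gA sQ pQ fb b0 bg'.
have le_pay t x w : payoff g A D Q t x w <= payoff g' A D Q t x w.
  rewrite lerD2l lerN2 ler_wpM2r //; last exact: ltW.
  by apply: sumr_ge0 => s _; exact: sq_ge0.
have gain t x w := le_trans (le_pay t x w) (gain' t x w).
have [P' [[sP' pP'] dP' eP' upP' _]] := riccati_solution sQ pQ e0 gain'.
have [P [[sP pP] dP eP _ supP]] := riccati_solution sQ pQ e0 gain.
exists P; split=> //; apply: geom_of_pairs => la lb x y ex ey l1.
have lePP' z : qf P z <= qf P' z.
  by apply: supP => t w; apply: le_trans (le_pay _ _ _) (upP' _ _ _).
pose W := worst g D P; pose F := closed_worst g A D P.
have dec z : qf P z - qf P' z + (g - g') * sq (W *m (A *m z)) <=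
    qf P (F *m z) - qf P' (F *m z).
  have := game_le sP' dP' (A *m z) (W *m (A *m z)).
  have := game_eq sP dP (A *m z); rewrite -!closed_worstE -/W -/F.
  by have := riccatiE z eP; have := riccatiE z eP'; lra.
have rP := qf_rot P la lb x y; have rP' := qf_rot P' la lb x y.
rewrite -ex -ey in rP rP'.
have h : (g - g') * (sq (W *m (A *m x)) + sq (W *m (A *m y))) <= 0.
  have : 0 <= (la ^+ 2 + lb ^+ 2 - 1) * ((qf P' x - qf P x) + (qf P' y - qf P y)).
    by rewrite mulr_ge0 ?subr_ge0 // addr_ge0 ?subr_ge0 ?lePP'.
  by have := dec x; have := dec y; lra.
rewrite pmulr_rle0 ?subr_gt0 // in h.
have := sq_ge0 (W *m (A *m x)); have := sq_ge0 (W *m (A *m y)) => h1 h2.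
have Wx : W *m (A *m x) = 0 by apply: sq_eq0; lra.
have Wy : W *m (A *m y) = 0 by apply: sq_eq0; lra.
apply: (geom_pairs gA) l1.
- by rewrite -ex closed_worstE -/W Wx mulmx0 addr0.
- by rewrite -ey closed_worstE -/W Wy mulmx0 addr0.
Qed.

(** The stabilizing solution lies below every supersolution: along its own
worst-case closed loop, which is stable, the difference can only decrease and tends
to a nonnegative limit. *)
Lemma riccati_compare g A (D : 'M[R]_(m, n)) Q P1 P2 (N : 'cV[R]_m -> R) :
  P1^T = P1 -> psd P1 -> posdef (margin g D P1) ->
  P2^T = P2 -> posdef (margin g D P2) ->
  geom_stable (closed_worst g A D P2) ->
  A^T *m gtilde g D P2 *m A + Q = P2 -> (forall x, 0 <= N x) ->
  (forall x, qf (gtilde g D P1) (A *m x) + qf Q x + N x <= qf P1 x) ->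
  forall x, qf P2 x + N x <= qf P1 x.
Proof.
move=> sP1 pP1 dP1 sP2 dP2 [C [r [C0 r0 r1 hF]]] eP2 N0 sup.
set F := closed_worst g A D P2 in hF.
have dec z : qf P2 z - qf P1 z + N z <= qf P2 (F *m z) - qf P1 (F *m z).
  have := game_le sP1 dP1 (A *m z) (worst g D P2 *m (A *m z)).
  have := game_eq sP2 dP2 (A *m z); rewrite -!closed_worstE -/F.
  by have := sup z; have := riccatiE z eP2; lra.
have [c c0 hc] := qf_bound P2.
have le z : qf P2 z - qf P1 z <= 0.
  apply: (@le0_geom R (c * C * sq z) r _ r0 r1) => k.
  have : qf P2 z - qf P1 z <= qf P2 (iter k (mulmx F) z) - qf P1 (iter k (mulmx F) z).
    elim: k => // k IH; apply: le_trans IH _ => /=.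
    have := dec (iter k (mulmx F) z); have := N0 (iter k (mulmx F) z); lra.
  have := pP1 (iter k (mulmx F) z); have := hc (iter k (mulmx F) z).
  by have := ler_wpM2l c0 (hF k z); lra.
by move=> x; have := dec x; have := le (F *m x); lra.
Qed.

(** The Lyapunov form [H], the sum of [sq (F^j x)] over [j < k], drops by half of
[sq x] along [F] once [F^k] contracts; this controls the resolvent on the whole unit
circle at once. *)
Lemma resolvent_bound F : geom_stable F ->
  exists2 C, 0 <= C & forall t (x y p q : 'cV[R]_m),
    F *m x + p = cos t *: x - sin t *: y -> F *m y + q = sin t *: x + cos t *: y ->
    sq x + sq y <= C * (sq p + sq q).
Proof.
move=> [C [r [C0 r0 r1 hF]]].
have [k hk] := @geom_small R C r (1 / 2) r0 r1 ltac:(lra).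
pose Fk j : 'M[R]_m := iter j (mulmx F) 1%:M.
have FkE j (z : 'cV_m) : Fk j *m z = iter j (mulmx F) z.
  by rewrite -iter_mulmxE mul1mx.
pose H := \sum_(j < k) (Fk j)^T *m Fk j.
have HE z : qf H z = \sum_(j < k) sq (iter j (mulmx F) z).
  rewrite (big_morph (fun M => qf M z) (fun M N => bl_addm M N z z) (bl_0m _ _)).
  by apply: eq_bigr => j _; rewrite -sq_mul FkE.
have sH : H^T = H.
  rewrite linear_sum; apply: eq_bigr => j _ /=; by rewrite trmx_mul trmxK.
have pH : psd H by move=> z; rewrite HE sumr_ge0 // => j _; exact: sq_ge0.
have dec z : qf H (F *m z) <= qf H z - sq z / 2.
  have e : qf H (F *m z) + sq z = qf H z + sq (iter k (mulmx F) z).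
    rewrite !HE; under eq_bigr do rewrite -iterSr.
    by rewrite -(big_ord_recr k (fun j => sq (iter j (mulmx F) z))) /= big_ord_recl /= addrC.
  have : sq (iter k (mulmx F) z) <= 1 / 2 * sq z.
    by apply: le_trans (hF k z) _; rewrite ler_wpM2r ?sq_ge0 // hk.
  lra.
have [c c0 hc] := qf_bound H.
(* small enough for the drop of [H] to absorb the term in [del] *)
pose del := (4 * (c + 1))^-1.
have d0 : 0 < del by rewrite invr_gt0 mulr_gt0 // ltr_wpDl.
have dc : del * c <= 1 / 4.
  have -> : del * c = 1 / 4 * (c / (c + 1)) by rewrite /del; field; rewrite gt_eqF // ltr_wpDl.
  by rewrite ler_piMr // ?ler_pdivrMr ?ltr_wpDl // ?mul1r ?lerDl //; lra.
have dV : 0 <= 1 + del^-1 by rewrite addr_ge0 // invr_ge0 ltW.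
exists (4 * ((1 + del^-1) * c)); first by rewrite !mulr_ge0.
move=> t x y p q ex ey; have := qf_rot H (cos t) (sin t) x y.
rewrite -ex -ey cos2Dsin2 mul1r.
have := young (F *m x) (- p) sH pH d0; have := young (F *m y) (- q) sH pH d0.
rewrite !opprK [qf H (- p)]blNl [qf H (- q)]blNl !blNr !opprK.
have d1 : 0 <= 1 + del by rewrite addr_ge0 // ltW.
have := ler_wpM2l d1 (dec x); have := ler_wpM2l d1 (dec y).
have := ler_wpM2l dV (hc p); have := ler_wpM2l dV (hc q).
have := ler_wpM2l (ltW d0) (hc x); have := ler_wpM2l (ltW d0) (hc y).
have := ler_wpM2r (sq_ge0 x) dc; have := ler_wpM2r (sq_ge0 y) dc.
have := mulr_ge0 (ltW d0) (sq_ge0 x); have := mulr_ge0 (ltW d0) (sq_ge0 y).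
lra.
Qed.
End Riccati.

(** * Robustness of an improved gain *)

Lemma stable_geomP (R : realType) m (A : 'M[R]_m) : stable A <-> geom_stable A.
Proof.
split=> [|gA]; first exact: stable_geom.
by apply: stable_of_pairs => a b x y; exact: geom_pairs.
Qed.

Section Robust.
Context {R : realType} {m n : nat}.
Variables (g kap : R) (A1 A' Q P : 'M[R]_m) (D : 'M[R]_(m, n)).
Hypotheses (g0 : 0 < g) (kap0 : 0 < kap) (pQ : psd Q) (sP : P^T = P) (pP : psd P).
Hypothesis dP : posdef (margin g D P).
Hypothesis slack : forall x, qf (gtilde g D P) (A' *m x) + qf Q x
  + kap * sq (A' *m x - A1 *m x) <= qf P x.

(** On an unstable mode of [A'] the value cannot decrease, so that [A'] and [A1]
agree on it. *)
Lemma slack_stable : geom_stable A1 -> geom_stable A'.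
Proof.
move=> gA; apply: geom_of_pairs => a b x y ex ey ab.
have rP := qf_rot P a b x y; rewrite -ex -ey in rP.
have := slack x; have := slack y.
have := gtilde_ge sP dP (A' *m x); have := gtilde_ge sP dP (A' *m y).
have := pQ x; have := pQ y.
have : 0 <= (a ^+ 2 + b ^+ 2 - 1) * (qf P x + qf P y).
  by rewrite mulr_ge0 ?subr_ge0 // addr_ge0.
have hx := sq_ge0 (A' *m x - A1 *m x); have hy := sq_ge0 (A' *m y - A1 *m y).
have kx := mulr_ge0 (ltW kap0) hx; have ky := mulr_ge0 (ltW kap0) hy.
move=> h1 h2 h3 h4 h5 h6 h7.
have : kap * sq (A' *m x - A1 *m x) <= 0 by lra.
have : kap * sq (A' *m y - A1 *m y) <= 0 by lra.
rewrite !pmulr_rle0 // => hy' hx'.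
have /subr0_eq ex1 : A' *m x - A1 *m x = 0.
  by apply: sq_eq0; apply/eqP; rewrite eq_le hx' hx.
have /subr0_eq ey1 : A' *m y - A1 *m y = 0.
  by apply: sq_eq0; apply/eqP; rewrite eq_le hy' hy.
by apply: (geom_pairs gA) ab; rewrite -?ex1 -?ey1.
Qed.

(** Only a disturbance equal to the worst one for [P], along a trajectory of the old
closed loop, meets the level [g] with equality; the stability of the old worst-case
closed loop [closed_worst g A1 D P] then bounds the disturbance by the defect from
equality, uniformly in the frequency. *)
Lemma slack_freq : geom_stable (closed_worst g A1 D P) ->
  exists2 b, 0 <= b < g & freq_bound A' D Q b.
Proof.
move=> /resolvent_bound[c1 c10 hres].
set W := worst g D P.
have [c2 c20 hc2] := sq_mul_bound (1%:M + D *m W).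
have [c3 c30 hc3] := sq_mul_bound D.
have [c4 c40 hc4] := sq_mul_bound (W *m A').
have [c5 c50 hc5] := posdef_coercive dP.
pose al := 4 * c4 * c1.
have al0 : 0 <= al by rewrite !mulr_ge0.
pose be := al * c2 / kap; pose ga := (al * c3 + 2) * c5.
have be0 : 0 <= be by rewrite divr_ge0 ?mulr_ge0 // ltW.
have ga0 : 0 <= ga by rewrite mulr_ge0 // addr_ge0 // mulr_ge0.
(* the term [g^-1] keeps [g - Ct^-1] nonnegative *)
pose Ct := be + ga + g^-1.
have Cg : g^-1 <= Ct by rewrite lerDr addr_ge0.
have Ct0 : 0 < Ct by apply: lt_le_trans Cg; rewrite invr_gt0.
exists (g - Ct^-1).
  apply/andP; split; last by rewrite gtrBl invr_gt0.
  by rewrite subr_ge0 -[leRHS]invrK lef_pV2 // posrE invr_gt0.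
move=> t x y u v _ ex ey.
pose hx := A' *m x - A1 *m x; pose hy := A' *m y - A1 *m y.
pose r := u - W *m (A' *m x); pose s := v - W *m (A' *m y).
have dec (z : 'cV_m) (w : 'cV_n) : A' *m z + D *m w = closed_worst g A1 D P *m z
    + ((1%:M + D *m W) *m (A' *m z - A1 *m z) + D *m (w - W *m (A' *m z))).
  rewrite closed_worstE -/W mulmxDl mul1mx !mulmxBr !mulmxA.
  by apply/matrixP => i j; rewrite !mxE; ring.
have := hres t x y _ _ (etrans (esym (dec x u)) ex) (etrans (esym (dec y v)) ey).
rewrite -/hx -/hy -/r -/s => hxy.
have Vx := sqD_le ((1%:M + D *m W) *m hx) (D *m r).
have Vy := sqD_le ((1%:M + D *m W) *m hy) (D *m s).
have ux : sq u <= 2 * sq r + 2 * (c4 * sq x).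
  have -> : u = r + W *m A' *m x by rewrite /r mulmxA subrK.
  by apply: le_trans (sqD_le _ _) _; have := hc4 x; lra.
have vy : sq v <= 2 * sq s + 2 * (c4 * sq y).
  have -> : v = s + W *m A' *m y by rewrite /s mulmxA subrK.
  by apply: le_trans (sqD_le _ _) _; have := hc4 y; lra.
have r0 : 0 <= qf (margin g D P) r by exact: posdef_psd.
have s0 : 0 <= qf (margin g D P) s by exact: posdef_psd.
pose V := kap * (sq hx + sq hy) + (qf (margin g D P) r + qf (margin g D P) s).
have V0 : 0 <= V by rewrite !addr_ge0 // mulr_ge0 ?addr_ge0 ?sq_ge0 // ltW.
have UV : sq u + sq v <= Ct * V.
  have e1 : sq u + sq v <= al * c2 * (sq hx + sq hy) + (al * c3 + 2) * (sq r + sq s).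
    have b1 : sq x + sq y <= 2 * c1 * (c2 * (sq hx + sq hy) + c3 * (sq r + sq s)).
      apply: le_trans hxy _; rewrite [2 * c1]mulrC -mulrA ler_wpM2l //.
      by have := hc2 hx; have := hc2 hy; have := hc3 r; have := hc3 s; lra.
    have := ler_wpM2l c40 b1; rewrite /al; lra.
  have e2 : (al * c3 + 2) * (sq r + sq s) <= ga * (qf (margin g D P) r + qf (margin g D P) s).
    rewrite /ga -mulrA ler_wpM2l ?addr_ge0 ?mulr_ge0 //.
    by have := hc5 r; have := hc5 s; lra.
  have e3 : al * c2 * (sq hx + sq hy) = be * (kap * (sq hx + sq hy)).
    by rewrite /be; field; rewrite gt_eqF.
  apply: (@le_trans _ _ ((be + ga) * V)); last by rewrite ler_wpM2r // lerDl invr_ge0 ltW.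
  have t1 : 0 <= be * (qf (margin g D P) r + qf (margin g D P) s).
    by rewrite mulr_ge0 // addr_ge0.
  have t2 : 0 <= ga * (kap * (sq hx + sq hy)).
    by rewrite mulr_ge0 // mulr_ge0 ?(ltW kap0) // addr_ge0 ?sq_ge0.
  by rewrite /V; lra.
have UV' : Ct^-1 * (sq u + sq v) <= V by rewrite mulrC ler_pdivrMr // mulrC.
have rP := qf_rot P (cos t) (sin t) x y.
rewrite -ex -ey cos2Dsin2 mul1r in rP.
have := slack x; have := slack y; rewrite -/hx -/hy.
have := complete_square (A' *m x) u sP (posdef_unit dP).
have := complete_square (A' *m y) v sP (posdef_unit dP).
rewrite -/W -/r -/s /V in UV' *; lra.
Qed.
End Robust.

(** * One policy update *)

Section Update.
Context {R : realType} {m d l n : nat}.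
Variable S : plant R m d l n.
Hypothesis hS : plant_ok S.
Implicit Types K : 'M[R]_(d, m).

Let g := gam S ^+ 2.
Let D := plD S.
Notation Acl K := (closed_loop S K).
Notation Q K := (stage_cost S K).

Lemma gam2_gt0 : 0 < g.
Proof. by have [_ _ g0] := hS; rewrite exprn_gt0. Qed.

Lemma gam2_neq0 : g != 0. Proof. by rewrite gt_eqF // gam2_gt0. Qed.

Lemma marginZ P : margin g D P = g *: (1%:M - gam S ^- 2 *: (D^T *m P *m D)).
Proof.
by rewrite scalerBr scalerA mulfV ?gam2_neq0 // scale1r scalemx1.
Qed.

Lemma posdef_margin P :
  posdef (margin g D P) <-> posdef (1%:M - gam S ^- 2 *: (D^T *m P *m D)).
Proof.
rewrite marginZ; set M := _ - _; have g0 := gam2_gt0.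
have e (x : 'cV_n) : (x^T *m (g *: M) *m x) 0 0 = g * (x^T *m M *m x) 0 0.
  exact: (bl_scalem g M x x).
split=> -[/symmxP sM h]; split.
- apply/symmxP; apply: (scalerI gam2_neq0); by rewrite -[RHS]sM linearZ.
- by move=> x /h; rewrite e pmulr_rgt0.
- by apply/symmxP; rewrite linearZ /= sM.
- by move=> x /h; rewrite e pmulr_rgt0.
Qed.

(** [I + D W], with [W] the worst-case gain, is the inverse of the transpose of
[I - gamma^-2 P D D^T]. *)
Lemma closed_worst_inv P K : P^T = P -> posdef (margin g D P) ->
  (invmx (1%:M - gam S ^- 2 *: (P *m D *m D^T)))^T *m Acl K =
  closed_worst g (Acl K) D P.
Proof.
move=> sP dP; set M := 1%:M - _.
have uG := posdef_unit dP; have GW : margin g D P *m worst g D P = D^T *m P.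
  by rewrite /worst -mulmxA mulKVmx.
have e : M^T *m (1%:M + D *m worst g D P) = 1%:M.
  have -> : M^T = 1%:M - gam S ^- 2 *: (D *m (D^T *m P)).
    by rewrite /M linearB /= trmx1 linearZ /= !trmx_mul trmxK sP.
  rewrite mulmxDr mulmx1 mulmxBl mul1mx -scalemxAl.
  have -> : D *m (D^T *m P) *m (D *m worst g D P) =
      g *: (D *m worst g D P) - D *m (D^T *m P).
    rewrite -[X in _ = _ - D *m X]GW /margin mulmxBl mul_scalar_mx mulmxBr.
    by rewrite -scalemxAr opprB addrC subrK !mulmxA.
  rewrite scalerBr scalerA mulVf ?gam2_neq0 // scale1r.
  by rewrite opprB [X in _ + X]addrCA subrr addr0 subrK.
have uM : M^T \in unitmx by have [] := mulmx1_unit e.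
rewrite trmx_inv -[invmx _]mulmx1 -e mulKmx // mulmxDl mul1mx.
by rewrite /closed_worst !mulmxA.
Qed.

Lemma stabilizingP K P : stabilizing_solution S K P <->
  [/\ P^T = P, psd P, posdef (margin g D P),
    (Acl K)^T *m gtilde g D P *m Acl K + Q K = P &
    geom_stable (closed_worst g (Acl K) D P)].
Proof.
split.
  case=> eP [sP pP] hP hF.
  have {}sP : P^T = P by apply/symmxP.
  have dP : posdef (margin g D P) by rewrite posdef_margin.
  rewrite closed_worst_inv // in hF.
  by split=> //; [exact: (subr0_eq eP)|apply/stable_geomP].
case=> sP pP dP eP gF; split.
- by rewrite -[in X in _ - X]eP subrr.
- by split=> //; apply/symmxP.
- by rewrite -posdef_margin.
- by rewrite closed_worst_inv //; apply/stable_geomP.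
Qed.

Lemma psd_stage_cost K : (Q K)^T = Q K /\ psd (Q K).
Proof. by have [/symmxP ? ?] := stage_cost_psd K hS. Qed.

Lemma ricP_spec K : feasible S K -> stabilizing_solution S K (ricP S K).
Proof.
move=> [/stable_geomP gA hK]; have [b b0 fb] := hinf_lt_freq hS gA hK.
have [sQ pQ] := psd_stage_cost K.
have [P [sP pP dP eP gF]] := bounded_real gA sQ pQ fb b0.
by apply: (@xgetPex _ 0 [set P | stabilizing_solution S K P]); exists P;
  apply/stabilizingP.
Qed.

Lemma tildePE K : tildeP S K = gtilde g D (ricP S K). Proof. by []. Qed.

Lemma gainGE K y : qf (gainG S K) y = qf (plR S) y + qf (tildeP S K) (plB S *m y).
Proof. by rewrite bl_addm [in RHS]bl_mull bl_mulr. Qed.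

Lemma tildeP_facts K : feasible S K ->
  (tildeP S K)^T = tildeP S K /\ psd (tildeP S K).
Proof.
move=> /ricP_spec/stabilizingP[sP pP dP _ _]; rewrite tildePE.
by split=> [|y]; [exact: gtilde_sym|apply: le_trans (gtilde_ge sP dP _)].
Qed.

Lemma gainG_posdef K : feasible S K -> posdef (gainG S K).
Proof.
move=> /tildeP_facts[sT pT]; have [_ dR _] := hS; split.
  by apply/symmxP; rewrite linearD /= !trmx_mul trmxK sT (posdef_sym dR) mulmxA.
move=> y y0; rewrite -[_ 0 0]/(qf (gainG S K) y) gainGE.
by apply: ltr_pwDl; [have [_] := dR; exact|exact: pT].
Qed.

(** The one-step cost of the gain [K'] against the value of [K] is an exact quadratic
in the change of gain, with slope [gradE] and curvature [gainG]. *)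
Lemma update_cost K K' x : feasible S K ->
  qf (tildeP S K) (Acl K' *m x) + qf (Q K') x =
  qf (ricP S K) x + 2 * bl 1%:M ((K' - K) *m x) (gradE S K *m x)
    + qf (gainG S K) ((K' - K) *m x).
Proof.
move=> fK; have [sT _] := tildeP_facts fK; have [_ dR _] := hS.
have /stabilizingP[_ _ _ eP _] := ricP_spec fK.
have sR := posdef_sym dR; move eT : (tildeP S K) sT => T sT.
pose y := (K' - K) *m x; pose z := Acl K *m x.
have eA : Acl K' *m x = z - plB S *m y.
  rewrite /z /y /closed_loop !mulmxBl !mulmxBr !mulmxA.
  by apply/matrixP => i j; rewrite !mxE; ring.
have eK : K' *m x = K *m x + y by rewrite /y mulmxBl addrC subrK.
have eE : gradE S K *m x = plR S *m (K *m x) - (plB S)^T *m (T *m z).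
  rewrite /gradE /gainG eT /z /closed_loop.
  rewrite !(mulmxBl, mulmxBr, mulmxDl) !mulmxA.
  by rewrite mulNmx opprD opprK addrA addrAC.
rewrite (riccatiE x eP) -tildePE eT -/z eA -/y gainGE eT !stage_costE // eK eE.
rewrite (blDr 1%:M) blNr !(bl_mulr 1%:M) !mul1mx.
have -> : bl ((plB S)^T) y (T *m z) = bl T (plB S *m y) z.
  by rewrite bl_mulr bl_mull.
rewrite !(blDl, blDr, blNl, blNr) (blC (K *m x) y sR) (blC z (plB S *m y) sT).
by ring.
Qed.

(** The value of [K] is a strict supersolution for [K'], with slack [c |E x|^2]; as the
change of gain factors through [E], the slack also controls the difference of the two
closed loops.  Robustness gives feasibility, and comparison of the supersolution with
the value of [K'] gives the decrease. *)
Lemma improve K K' (M : 'M[R]_d) c : feasible S K -> 0 < c ->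
  K' - K = M *m gradE S K ->
  (forall x, 2 * bl 1%:M ((K' - K) *m x) (gradE S K *m x)
    + qf (gainG S K) ((K' - K) *m x) <= - (c * sq (gradE S K *m x))) ->
  [/\ feasible S K',
    forall x, qf (ricP S K') x + c * sq (gradE S K *m x) <= qf (ricP S K) x &
    forall y, qf (gainG S K') y <= qf (gainG S K) y].
Proof.
move=> fK c0 eM dec; have [/stable_geomP gA _] := fK.
have /stabilizingP[sP pP dP eP gF] := ricP_spec fK.
have imp x : qf (gtilde g D (ricP S K)) (Acl K' *m x) + qf (Q K') x
    + c * sq (gradE S K *m x) <= qf (ricP S K) x.
  by rewrite -tildePE update_cost //; have := dec x; lra.
have [c1 c10 hc1] := sq_mul_bound (plB S *m M).
pose kap := c / (c1 + 1).
have c1p : 0 < c1 + 1 by rewrite ltr_wpDl.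
have kap0 : 0 < kap by rewrite divr_gt0.
have slack x : qf (gtilde g D (ricP S K)) (Acl K' *m x) + qf (Q K') x
    + kap * sq (Acl K' *m x - Acl K *m x) <= qf (ricP S K) x.
  apply: le_trans (imp x); rewrite lerD2l /kap mulrAC ler_pdivrMr // -mulrA.
  rewrite ler_pM2l // mulrC; apply: (@le_trans _ _ (c1 * sq (gradE S K *m x))).
    have -> : Acl K' *m x - Acl K *m x = - (plB S *m M *m (gradE S K *m x)).
      rewrite -mulmxA (mulmxA M) -eM /closed_loop !mulmxBl !mulmxBr !mulmxA.
      by apply/matrixP => i j; rewrite !mxE; ring.
    by rewrite blNl blNr opprK.
  by rewrite ler_wpM2r ?sq_ge0 // lerDl.
have [sQ' pQ'] := psd_stage_cost K'.
have gA' := slack_stable kap0 pQ' sP pP dP slack gA.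
have [b b0 fb] := slack_freq gam2_gt0 kap0 sP dP slack gF.
have fK' : feasible S K'.
  by split; [apply/stable_geomP|exact: (freq_hinf_lt hS gA' b0 fb)].
have /stabilizingP[sP' pP' dP' eP' gF'] := ricP_spec fK'.
have le x : qf (ricP S K') x + c * sq (gradE S K *m x) <= qf (ricP S K) x.
  apply: (riccati_compare (N := fun x => c * sq (gradE S K *m x)) sP pP dP sP' dP' gF' eP') => //.
  by move=> z; rewrite mulr_ge0 ?sq_ge0 // ltW.
split; [exact: fK'|exact: le|move=> y].
rewrite [leLHS]gainGE [leRHS]gainGE lerD2l; apply: (gtilde_mono sP' sP dP' dP) => z.
apply: le_trans (le z); rewrite lerDl mulr_ge0 ?sq_ge0 //; exact: ltW.
Qed.

(** With [K' - K = - 2 eta E], the curvature term [4 eta^2 |E x|_G^2] is at most half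
of the linear term [4 eta |E x|^2]. *)
Lemma natural_step K L eta : feasible S K -> 0 < eta -> eta * L <= 1 / 2 ->
  (forall y, qf (gainG S K) y <= L * sq y) ->
  forall x, 2 * bl 1%:M ((- (2 * eta))%:M *m gradE S K *m x) (gradE S K *m x)
    + qf (gainG S K) ((- (2 * eta))%:M *m gradE S K *m x)
    <= - (2 * eta * sq (gradE S K *m x)).
Proof.
move=> fK e0 eL hL x; rewrite -!mulmxA; set y := gradE S K *m x.
rewrite mul_scalar_mx !(blZl, blZr).
have := ler_wpM2l (mulr_ge0 (ltW e0) (ltW e0)) (hL y).
have := ler_wpM2r (mulr_ge0 (ltW e0) (sq_ge0 y)) eL; lra.
Qed.

(** With [K' - K = - 2 eta G^-1 E], linear and curvature terms are both multiples of
the form of [G^-1] at [E x], which dominates [|E x|^2 / L] by Cauchy-Schwarz. *)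
Lemma gauss_newton_step K L eta : feasible S K -> 0 < eta -> eta <= 1 / 2 -> 0 < L ->
  (forall y, qf (gainG S K) y <= L * sq y) ->
  let M := - (2 * eta) *: invmx (gainG S K) in
  forall x, 2 * bl 1%:M (M *m gradE S K *m x) (gradE S K *m x)
    + qf (gainG S K) (M *m gradE S K *m x)
    <= - (2 * eta / L * sq (gradE S K *m x)).
Proof.
move=> fK e0 e1 L0 hL M x; have dG := gainG_posdef fK.
have sG := posdef_sym dG; have uG := posdef_unit dG; have pG := posdef_psd dG.
rewrite -!mulmxA; set y := gradE S K *m x; set G := gainG S K in uG sG pG hL M *.
have -> : M *m y = - (2 * eta) *: (invmx G *m y) by rewrite scalemxAl.
have sI := tr_invmx_sym sG.
have e2 : qf G (invmx G *m y) = qf (invmx G) y.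
  by rewrite bl_mull bl_mulr sI mulVmx // mul1mx.
have e3 : bl 1%:M (invmx G *m y) y = qf (invmx G) y.
  by rewrite bl_mull mulmx1 sI.
have e4 : bl G (invmx G *m y) y = sq y.
  by rewrite bl_mull sI mulVmx.
rewrite !(blZl, blZr) e2 e3.
have i0 : 0 <= qf (invmx G) y by rewrite -e2.
have lb : sq y <= L * qf (invmx G) y.
  have [->|y0] := eqVneq y 0; first by rewrite !bl0l mulr0.
  rewrite -(ler_pM2l (sq_gt0 y0)) -expr2 -{1}e4.
  apply: le_trans (cauchy_schwarz _ _ sG pG) _; rewrite e2.
  by have := ler_wpM2l i0 (hL y); congr (_ <= _); ring.
have : 2 * eta / L * sq y <= 2 * eta * qf (invmx G) y.
  rewrite mulrAC ler_pdivrMr // -(mulrA (2 * eta)) ler_pM2l ?mulr_gt0 //.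
  by rewrite mulrC.
have := ler_wpM2r (mulr_ge0 (ltW e0) i0) e1; lra.
Qed.

End Update.

(** * Norms *)

Section Norms.
Context {R : realType}.

Lemma fnorm_col p (x : 'cV[R]_p) : fnorm x = Num.sqrt (sq x).
Proof.
rewrite sq_sum /fnorm; congr Num.sqrt; apply: eq_bigr => i _.
by rewrite big_ord1.
Qed.

Lemma opnorm_bound p q (M : 'M[R]_(p, q)) : 0 <= opnorm M /\
  forall x, sq (M *m x) <= opnorm M ^+ 2 * sq x.
Proof.
have [c c0 hc] := sq_mul_bound M.
set E := [set fnorm (M *m x) | x in [set x : 'cV[R]_q | fnorm x <= 1]].
have ubE : has_ubound E.
  exists (Num.sqrt c) => _ [x /= x1 <-]; rewrite fnorm_col ler_wsqrtr //.
  apply: le_trans (hc x) _; rewrite ler_piMr //.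
  by move: x1; rewrite fnorm_col -[leRHS]sqrtr1 ler_sqrt ?ler01.
have o0 : 0 <= opnorm M.
  apply: ub_le_sup => //; exists 0; last by rewrite mulmx0 fnorm_col bl0l sqrtr0.
  by rewrite /= fnorm_col bl0l sqrtr0.
split=> // x; have [->|x0] := eqVneq x 0; first by rewrite mulmx0 !bl0l mulr0.
have sx := sq_gt0 x0; pose s := Num.sqrt (sq x).
have s0 : 0 < s by rewrite sqrtr_gt0.
have s2 : s ^+ 2 = sq x by rewrite sqr_sqrtr // ltW.
have : fnorm (M *m (s^-1 *: x)) <= opnorm M.
  apply: ub_le_sup => //; exists (s^-1 *: x) => //=.
  by rewrite fnorm_col blZl blZr mulrA -expr2 -s2 exprVn mulVf ?sqrtr1 // expf_neq0 ?gt_eqF.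
rewrite fnorm_col -scalemxAr blZl blZr mulrA -expr2 => h.
have : s^-1 ^+ 2 * sq (M *m x) <= opnorm M ^+ 2.
  rewrite -(sqr_sqrtr (_ : 0 <= s^-1 ^+ 2 * sq (M *m x))); last first.
    by rewrite mulr_ge0 ?sq_ge0 ?sqr_ge0.
  by rewrite ler_pXn2r // nnegrE sqrtr_ge0.
by rewrite exprVn mulrC ler_pdivrMr ?exprn_gt0 // s2.
Qed.

Lemma qf_opnorm p (M : 'M[R]_p) x : psd M -> qf M x <= opnorm M * sq x.
Proof.
move=> pM; have [op0 ho] := opnorm_bound M.
rewrite -(ler_pXn2r (n := 2)) ?nnegrE ?mulr_ge0 ?sq_ge0 //.
have -> : qf M x = bl 1%:M x (M *m x) by rewrite bl_mulr mul1mx.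
have p1 : psd (1%:M : 'M[R]_p) by move=> z; exact: sq_ge0.
apply: le_trans (cauchy_schwarz _ _ (trmx1 _ _) p1) _.
by have := ler_wpM2l (sq_ge0 x) (ho x); congr (_ <= _); ring.
Qed.

Lemma fnorm_sum_cols p q (M : 'M[R]_(p, q)) :
  fnorm M ^+ 2 = \sum_j sq (M *m delta_mx j 0).
Proof.
rewrite sqr_sqrtr; last by do 2!apply: sumr_ge0 => ? _; rewrite sqr_ge0.
rewrite exchange_big; apply: eq_bigr => j _; rewrite sq_sum.
by apply: eq_bigr => i _; rewrite -colE mxE.
Qed.
End Norms.

Lemma sum_le_telescope (R : realType) (f phi : nat -> R) c N :
  (forall k, c * f k <= phi k - phi k.+1) ->
  c * \sum_(0 <= k < N) f k <= phi 0%N - phi N.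
Proof.
move=> h; rewrite mulr_sumr; elim: N => [|N IH]; first by rewrite big_nil subrr.
by rewrite big_nat_recr //=; have := h N; lra.
Qed.

(* The first conjunct of the conclusion says that the sequence never leaves the
   feasible set, so that every [gradE S (K k)] below is the actual E_{K_k},
   which exists only for feasible gains. *)
Theorem theorem4p4 (R : realType) (m d l n : nat) (S : plant R m d l n)
    (Kstar : 'M[R]_(d, m)) (eta : R) (K : nat -> 'M[R]_(d, m))
    (hS : plant_ok S)
    (hopt : global_optimum S Kstar)
    (hform : Kstar =
       invmx (gainG S Kstar) *m (plB S)^T *m tildeP S Kstar *m plA S)
    (hK0 : feasible S (K 0%N))
    (hK0fin : ((opnorm (K 0%N))%:E < +oo)%E)
    (heta : 0 < eta)
    (hiter :
       (natural_pg S eta K /\ eta <= 1 / (2 * opnorm (gainG S (K 0%N)))) \/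
       (gauss_newton S eta K /\ eta <= 1 / 2)) :
  (forall k, feasible S (K k)) /\
  exists c : R, forall N : nat, (1 <= N)%N ->
    1 / N%:R * \sum_(0 <= k < N) fnorm (gradE S (K k)) ^+ 2 <= c / N%:R.
Proof.
(* the curvature decreases along the iteration, so one bound serves all steps *)
set L0 := opnorm (gainG S (K 0%N)).
have pG0 : psd (gainG S (K 0%N)) by apply/posdef_psd/gainG_posdef.
have L00 : 0 <= L0 by have [] := opnorm_bound (gainG S (K 0%N)).
have hL0 y : qf (gainG S (K 0%N)) y <= L0 * sq y by exact: qf_opnorm.
have [c c0 step] : exists2 c : R, 0 < c & forall k, feasible S (K k) ->
    (forall y, qf (gainG S (K k)) y <= L0 * sq y) ->
    [/\ feasible S (K k.+1),
      forall x, qf (ricP S (K k.+1)) x + c * sq (gradE S (K k) *m x)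
        <= qf (ricP S (K k)) x &
      forall y, qf (gainG S (K k.+1)) y <= qf (gainG S (K k)) y].
  case: hiter => -[it he].
    (* if [L0] were 0, the bound on the stepsize would read [eta <= 0] *)
    have Lp : 0 < L0.
      rewrite lt_def L00 andbT; apply: contraTneq heta => Lz.
      by move: he; rewrite -/L0 Lz mulr0 invr0 mulr0 -leNgt.
    exists (2 * eta); first by rewrite mulr_gt0.
    move=> k fk hk; have eM : K k.+1 - K k = (- (2 * eta))%:M *m gradE S (K k).
      by rewrite it addrAC subrr add0r mul_scalar_mx scaleNr.
    apply: (improve hS fk _ eM); first by rewrite mulr_gt0.
    rewrite eM; apply: natural_step fk heta _ hk => //.
    by move: he; rewrite -/L0 ler_pdivlMr ?mulr_gt0 //; lra.
  exists (2 * eta / (L0 + 1)); first by rewrite divr_gt0 ?mulr_gt0 // ltr_wpDl.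
  move=> k fk hk.
  have eM : K k.+1 - K k = (- (2 * eta) *: invmx (gainG S (K k))) *m gradE S (K k).
    by rewrite it addrAC subrr add0r -scalemxAl scaleNr.
  apply: (improve hS fk _ eM); first by rewrite divr_gt0 ?mulr_gt0 // ltr_wpDl.
  have L1 : 0 < L0 + 1 by rewrite ltr_wpDl.
  have hk1 y : qf (gainG S (K k)) y <= (L0 + 1) * sq y.
    by apply: le_trans (hk y) _; rewrite ler_wpM2r ?sq_ge0 // lerDl.
  rewrite eM; exact: (gauss_newton_step hS fk heta he L1 hk1).
have inv k : feasible S (K k) /\ forall y, qf (gainG S (K k)) y <= L0 * sq y.
  elim: k => [//|k [fk hk]]; have [fk' _ mono] := step k fk hk.
  by split; [exact: fk'|move=> y; exact: le_trans (mono y) (hk y)].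
have feas k : feasible S (K k) by have [] := inv k.
split; first exact: feas.
(* [phi] is the trace of the value matrix *)
pose phi k := \sum_j qf (ricP S (K k)) (delta_mx j 0).
have phi0 k : 0 <= phi k.
  apply: sumr_ge0 => j _.
  by have /(stabilizingP hS)[_ pP _ _ _] := ricP_spec hS (feas k); exact: pP.
have dec k : c * fnorm (gradE S (K k)) ^+ 2 <= phi k - phi k.+1.
  rewrite fnorm_sum_cols mulr_sumr -sumrB; apply: ler_sum => j _.
  have [fk hk] := inv k; have [_ le _] := step k fk hk.
  by rewrite lerBrDr [leLHS]addrC; exact: le.
exists (phi 0%N / c) => N N1.
rewrite mulrAC mul1r ler_wpM2r ?invr_ge0 ?ler0n // ler_pdivlMr // mulrC.
by apply: le_trans (sum_le_telescope N dec) _; rewrite gerBl.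
Qed.
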